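(* Let $s\ge1$, $L\ge1$, widths $d_0=s,\dots,d_{L+1}=N_{\rm obs}$, matrices $W_\ell\in\mathbb{R}^{d_{\ell+1}\times d_\ell}$, vectors $\mathbf{v}_\ell\in\mathbb{R}^{d_{\ell+1}}$ ($\ell=0,\dots,L$), and smooth $\sigma:\mathbb{R}\to\mathbb{R}$ applied componentwise with $\sup_x|\sigma^{(n)}(x)|\le\xi\tau^n n!$ for all $n\ge1$, for some $\xi,\tau>0$. Let $\beta_j:=\max_{1\le p\le d_1}|W_{0,p,j}|$ be bounded as below, $R_\ell$ positive numbers with $\|W_\ell\|_\infty:=\max_p\sum_q|W_{\ell,p,q}|\le R_\ell$ ($\ell\ge1$), $P_0:=1$, $P_k:=\prod_{t=1}^k(\xi\tau R_t)$, $S_L:=\tau\sum_{k=0}^{L-1}P_k$ and $C_L:=\max\{\|G^{[L]}_\theta\|_\infty,P_L/S_L\}$, where $\|G^{[L]}_\theta\|_\infty=\sup_{\mathbf{y}\in[0,1]^s}\max_p|G^{[L]}_\theta(\mathbf{y})_p|$. Let a positive sequence $(b_j)_{j\ge1}$ and a constant $C>0$ be given, and suppose the network parameters are restricted so that: $R_\ell\le\rho$ for all $\ell=1,\dots,L-1$ for some $\rho>0$; $\beta_j\le b_j/S_L$ for all $j=1,\dots,s$ (i.e. $\max_p|W_{0,p,j}|\le b_j/S_L$); and $C_L\le C$. Let positive weights $\gamma_{\mathfrak u}$ ($\mathfrak u\subseteq\{1:s\}$, $\gamma_\emptyset=1$) be given. Then $S_L\le\tau L$ if $\xi\tau\rho=1$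 and $S_L\le\tau\frac{(\xi\tau\rho)^L-1}{\xi\tau\rho-1}$ otherwise, and moreover: (a) If $G:[0,1]^s\to\mathbb{R}^{N_{\rm obs}}$ satisfies $|\partial^{\boldsymbol\nu}G(\mathbf{y})_p|\le C\,|\boldsymbol\nu|!\,\mathbf{b}^{\boldsymbol\nu}$ for all $\boldsymbol\nu\in\mathbb{N}_0^s$, all $\mathbf y$ and all $1\le p\le N_{\rm obs}$, then the non-periodic network ($G^{[0]}_\theta(\mathbf{y})=W_0\mathbf{y}+\mathbf{v}_0$, $G^{[\ell]}_\theta=W_\ell\sigma(G^{[\ell-1]}_\theta)+\mathbf{v}_\ell$) satisfies the same bound, and for all $p$: $$\max\{\|G(\cdot)_p\|^2_{\mathcal{W}_{1,\boldsymbol\gamma}},\|G^{[L]}_\theta(\cdot)_p\|^2_{\mathcal{W}_{1,\boldsymbol\gamma}}\}\le C^2\sum_{\mathfrak u}\frac1{\gamma_{\mathfrak u}}\Big(|\mathfrak u|!\prod_{j\in\mathfrak u}b_j\Big)^2,$$ $$\|(G(\cdot)_p-G^{[L]}_\theta(\cdot)_p)^2\|^2_{\mathcal{W}_{1,\boldsymbol\gamma}}\le16C^4\sum_{\mathfrak u}\frac1{\gamma_{\mathfrak u}}\Big((|\mathfrak u|+1)!\prod_{j\in\mathfrak u}b_j\Big)^2.$$ (b) If $G:[0,1]^s\to\mathbb{R}^{N_{\rm obs}}$ is one-periodic in each variable and satisfies $|\partial^{\boldsymbol\nu}G(\mathbf{y})_p|\le C(2\pi)^{|\boldsymbol\nu|}\sum_{\mathbf{m}\le\boldsymbol\nu}|\mathbf{m}|!\,\mathbf{b}^{\mathbf{m}}\mathcal{S}(\boldsymbol\nu,\mathbf{m})$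 for all $\boldsymbol\nu$, $\mathbf y$, $p$, then the periodic network ($G^{[0]}_\theta(\mathbf{y})=W_0\sin(2\pi\mathbf{y})+\mathbf{v}_0$, $G^{[\ell]}_\theta=W_\ell\sigma(G^{[\ell-1]}_\theta)+\mathbf{v}_\ell$) satisfies the same bound, and for every integer $\alpha\ge1$ and all $p$: $$\max\{\|G(\cdot)_p\|^2_{\mathcal{W}_{\alpha,\boldsymbol\gamma}},\|G^{[L]}_\theta(\cdot)_p\|^2_{\mathcal{W}_{\alpha,\boldsymbol\gamma}}\}\le C^2\sum_{\mathfrak u}\frac{(2\pi)^{2\alpha|\mathfrak u|}}{\gamma_{\mathfrak u}}\Big(\sum_{\mathbf m_{\mathfrak u}\le\boldsymbol\alpha_{\mathfrak u}}|\mathbf m_{\mathfrak u}|!\,\mathcal{S}(\boldsymbol\alpha_{\mathfrak u},\mathbf m_{\mathfrak u})\prod_{j\in\mathfrak u}b_j^{m_j}\Big)^2,$$ $$\|(G(\cdot)_p-G^{[L]}_\theta(\cdot)_p)^2\|^2_{\mathcal{W}_{\alpha,\boldsymbol\gamma}}\le16C^4\sum_{\mathfrak u}\frac{(2\pi)^{2\alpha|\mathfrak u|}}{\gamma_{\mathfrak u}}\Big(\sum_{\mathbf m_{\mathfrak u}\le\boldsymbol\alpha_{\mathfrak u}}(|\mathbf m_{\mathfrak u}|+1)!\,\mathcal{S}(\boldsymbol\alpha_{\mathfrak u},\mathbf m_{\mathfrak u})\prod_{j\in\mathfrak u}b_j^{m_j}\Big)^2.$$ (c) Under the hypotheses of (b),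 for every integer $\alpha\ge2$ and all $p$: $$\max\{\|G(\cdot)_p\|_{\mathcal{K}_{\alpha,\boldsymbol\gamma}},\|G^{[L]}_\theta(\cdot)_p\|_{\mathcal{K}_{\alpha,\boldsymbol\gamma}}\}\le C\max_{\mathfrak u}\frac{(2\pi)^{\alpha|\mathfrak u|}}{\gamma_{\mathfrak u}}\sum_{\mathbf m_{\mathfrak u}\le\boldsymbol\alpha_{\mathfrak u}}|\mathbf m_{\mathfrak u}|!\,\mathcal{S}(\boldsymbol\alpha_{\mathfrak u},\mathbf m_{\mathfrak u})\prod_{j\in\mathfrak u}b_j^{m_j},$$ $$\|(G(\cdot)_p-G^{[L]}_\theta(\cdot)_p)^2\|_{\mathcal{K}_{\alpha,\boldsymbol\gamma}}\le4C^2\max_{\mathfrak u}\frac{(2\pi)^{\alpha|\mathfrak u|}}{\gamma_{\mathfrak u}}\sum_{\mathbf m_{\mathfrak u}\le\boldsymbol\alpha_{\mathfrak u}}(|\mathbf m_{\mathfrak u}|+1)!\,\mathcal{S}(\boldsymbol\alpha_{\mathfrak u},\mathbf m_{\mathfrak u})\prod_{j\in\mathfrak u}b_j^{m_j}.$$ Here sums and maxima over $\mathfrak u$ range over all subsets $\mathfrak u\subseteq\{1,\dots,s\}$.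
   Context: For $\boldsymbol\nu\in\mathbb{N}_0^s$: $|\boldsymbol\nu|=\sum_j\nu_j$, $\partial^{\boldsymbol\nu}=\prod_j(\partial/\partial y_j)^{\nu_j}$, $\mathbf b^{\boldsymbol\nu}=\prod_jb_j^{\nu_j}$, $\le$ is componentwise. $\mathcal{S}(n,k)$ is the Stirling number of the second kind ($\mathcal{S}(n,0)=\delta_{n,0}$, $\mathcal{S}(n,k)=0$ for $k>n$, $\mathcal{S}(n,k)=\frac1{k!}\sum_{i=0}^k(-1)^{k-i}\binom ki i^n$ otherwise), $\mathcal{S}(\boldsymbol\nu,\mathbf m)=\prod_j\mathcal{S}(\nu_j,m_j)$. For $\mathfrak u\subseteq\{1,\dots,s\}$: $\boldsymbol\alpha_{\mathfrak u}=(\alpha,\dots,\alpha)\in\mathbb{N}_0^{\mathfrak u}$, $\mathbf m_{\mathfrak u}\in\mathbb{N}_0^{\mathfrak u}$, $|\mathbf m_{\mathfrak u}|=\sum_{j\in\mathfrak u}m_j$, $\mathcal{S}(\boldsymbol\alpha_{\mathfrak u},\mathbf m_{\mathfrak u})=\prod_{j\in\mathfrak u}\mathcal{S}(\alpha,m_j)$, $\partial^{\boldsymbol\alpha_{\mathfrak u}}=\prod_{j\in\mathfrak u}(\partial/\partial y_j)^\alpha$. For sufficiently smooth $F:[0,1]^s\to\mathbb{R}$, $\|F\|^2_{\mathcal{W}_{\alpha,\boldsymbol\gamma}}:=\sum_{\mathfrak u}\frac1{\gamma_{\mathfrak u}}\int_{[0,1]^{|\mathfrak u|}}\big|\int_{[0,1]^{s-|\mathfrak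 u|}}\partial^{\boldsymbol\alpha_{\mathfrak u}}F(\mathbf y)\,d\mathbf y_{\{1:s\}\setminus\mathfrak u}\big|^2d\mathbf y_{\mathfrak u}$ (for $\alpha=1$ this is the unanchored weighted Sobolev norm). $\|\cdot\|_{\mathcal{K}_{\alpha,\boldsymbol\gamma}}$ is the norm of the non-Hilbert weighted Korobov space of one-periodic functions, which satisfies for every sufficiently smooth one-periodic $F$: $\|F\|_{\mathcal{K}_{\alpha,\boldsymbol\gamma}}\le\max_{\mathfrak u}\frac1{\gamma_{\mathfrak u}}\int_{[0,1]^{|\mathfrak u|}}\big|\int_{[0,1]^{s-|\mathfrak u|}}\partial^{\boldsymbol\alpha_{\mathfrak u}}F(\mathbf y)\,d\mathbf y_{\{1:s\}\setminus\mathfrak u}\big|d\mathbf y_{\mathfrak u}$. *)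

(* Defs.v *)
From HB Require Import structures.
From mathcomp Require Import all_boot all_order all_algebra.
From mathcomp Require Import all_classical all_reals all_analysis.
Set Implicit Arguments. Unset Strict Implicit. Unset Printing Implicit Defensive.
Import Order.TTheory GRing.Theory Num.Theory.
Import numFieldNormedType.Exports.
Local Open Scope classical_set_scope.
Local Open Scope ring_scope.

Section Defs.
Context {R : realType} {s : nat}.
Implicit Types (F : 'rV[R]_s -> R) (y : 'rV[R]_s).

Definition ev (j : 'I_s) : 'rV[R]_s := delta_mx 0 j.

Definition pd (j : 'I_s) F : 'rV[R]_s -> R := fun y => derive F y (ev j).

Definition pds (js : seq 'I_s) F : 'rV[R]_s -> R := foldr pd F js.

Definition dnu (nu : 'I_s -> nat) F : 'rV[R]_s -> R :=
  foldr (fun j H => iter (nu j) (pd j) H) F (enum 'I_s).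

Definition dalpha (u : {set 'I_s}) (a : nat) F : 'rV[R]_s -> R :=
  foldr (fun j H => iter a (pd j) H) F (enum u).

Definition smooth_on (A : set 'rV[R]_s) F : Prop :=
  forall js : seq 'I_s,
    (forall y, A y -> {for y, continuous (pds js F)}) /\
    (forall (j : 'I_s) y, A y -> derivable (pds js F) y (ev j)).

Definition cube : set 'rV[R]_s := [set y | forall j, 0 <= y 0 j <= 1].
Definition ocube : set 'rV[R]_s := [set y | forall j, 0 < y 0 j < 1].

Definition upd y (j : 'I_s) (t : R) : 'rV[R]_s :=
  \row_i (if i == j then t else y 0 i).

Definition intc (j : 'I_s) F : 'rV[R]_s -> R :=
  fun y => \int[lebesgue_measure]_(t in `[(0:R), 1]) F (upd y j t).

Definition intcs (js : seq 'I_s) F : 'rV[R]_s -> R := foldr intc F js.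

Definition wnorm2 (a : nat) (gamma : {set 'I_s} -> R) F : R :=
  \sum_(u : {set 'I_s}) (gamma u)^-1 *
    intcs (enum u)
      (fun y => (intcs (enum (~: u)) (dalpha u a F) y) ^+ 2) 0.

(** Fourier coefficient |F^(h)|, F^(h) = int_{[0,1]^s} F(y) exp(-2 pi i h.y) dy *)
Definition fourier_abs (h : 'I_s -> int) F : R :=
  let ph y := 2 * pi * \sum_j (h j)%:~R * y 0 j in
  Num.sqrt ((intcs (enum 'I_s) (fun y => F y * cos (ph y)) 0) ^+ 2 +
            (intcs (enum 'I_s) (fun y => F y * sin (ph y)) 0) ^+ 2).

Definition r_alpha (a : nat) (gamma : {set 'I_s} -> R) (h : 'I_s -> int) : R :=
  (gamma (finset (fun j => h j != 0)))^-1 * \prod_(j | h j != 0) ((`|h j|%:~R : R) ^+ a).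

Definition korobov_norm (a : nat) (gamma : {set 'I_s} -> R) F : R :=
  sup [set x | exists h : 'I_s -> int, x = fourier_abs h F * r_alpha a gamma h].

Definition periodic1 F : Prop := forall (j : 'I_s) y, F (y + ev j) = F y.

End Defs.

Definition stirling2 {R : realType} (n k : nat) : R :=
  if k == 0%N then (n == 0%N)%:R
  else if (n < k)%N then 0
  else (k`!%:R)^-1 * \sum_(i < k.+1) (-1) ^+ (k - i) * 'C(k, i)%:R * (i%:R) ^+ n.

Definition mxinf {R : realType} {m n : nat} (A : 'M[R]_(m, n)) : R :=
  \big[Num.max/0]_(p < m) \sum_(q < n) `|A p q|.

Fixpoint net {R : realType} (d : nat -> nat) (W : forall l, 'M[R]_(d l.+1, d l))
  (v : forall l, 'I_(d l.+1) -> R) (sigma phi : R -> R) (l : nat)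
  : 'rV[R]_(d 0) -> 'I_(d l.+1) -> R :=
  match l return 'rV[R]_(d 0) -> 'I_(d l.+1) -> R with
  | 0 => fun y p => \sum_(j < d 0) W 0%N p j * phi (y 0 j) + v 0%N p
  | l'.+1 => fun y p =>
      \sum_(q < d l'.+1) W l'.+1 p q * sigma (@net R d W v sigma phi l' y q) + v l'.+1 p
  end.

Definition phi_id {R : realType} : R -> R := fun t => t.
Definition phi_sin {R : realType} : R -> R := fun t => sin (2 * pi * t).

Definition Pk {R : realType} (xi tau : R) (Rl : nat -> R) (k : nat) : R :=
  \prod_(1 <= t < k.+1) (xi * tau * Rl t).
Definition SL {R : realType} (xi tau : R) (Rl : nat -> R) (L : nat) : R :=
  tau * \sum_(0 <= k < L) Pk xi tau Rl k.

Definition netsup {R : realType} {s N : nat} (G : 'rV[R]_s -> 'I_N -> R) : R :=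
  sup [set x | exists y p, cube y /\ x = `|G y p|].

Definition CL {R : realType} {s N : nat} (G : 'rV[R]_s -> 'I_N -> R)
  (xi tau : R) (Rl : nat -> R) (L : nat) : R :=
  Num.max (netsup G) (Pk xi tau Rl L / SL xi tau Rl L).

(** multi-index notation; coordinate j : 'I_s corresponds to the paper's
    index j+1, so b_{j+1} is attached to it *)
Definition nabs {s : nat} (nu : 'I_s -> nat) : nat := (\sum_j nu j)%N.
Definition bpow {R : realType} {s : nat} (b : nat -> R) (nu : 'I_s -> nat) : R :=
  \prod_(j : 'I_s) b (nat_of_ord j).+1 ^+ nu j.

Definition boundA {R : realType} {s : nat} (C : R) (b : nat -> R) (nu : 'I_s -> nat) : R :=
  C * (nabs nu)`!%:R * bpow b nu.

Definition boundB {R : realType} {s : nat} (C : R) (b : nat -> R) (nu : 'I_s -> nat) : R :=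
  C * (2 * pi) ^+ (nabs nu) *
  \sum_(m : {ffun 'I_s -> 'I_((\max_(j : 'I_s) nu j)%N).+1} | [forall j, (m j <= nu j)%N])
     ((nabs (fun j => nat_of_ord (m j)))`!%:R * bpow b (fun j => nat_of_ord (m j)) *
      \prod_(j : 'I_s) stirling2 (nu j) (m j)).

(** sum_{m_u <= alpha_u} (|m_u| + k)! S(alpha_u, m_u) prod_{j in u} b_j^{m_j};
    m_u in N_0^u is encoded as m : 'I_s -> 'I_(alpha+1) vanishing outside u *)
Definition sumK {R : realType} {s : nat} (b : nat -> R) (a : nat) (u : {set 'I_s}) (k : nat) : R :=
  \sum_(m : {ffun 'I_s -> 'I_a.+1} | [forall j, (j \notin u) ==> (m j == ord0)])
     ((\sum_(j in u) nat_of_ord (m j)) + k)%N`!%:R *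
     \prod_(j in u) stirling2 a (m j) *
     \prod_(j in u) b (nat_of_ord j).+1 ^+ m j.

Arguments net {R d} W v sigma phi l _ _.

(* Main.v *)
Require Import Defs.
From HB Require Import structures.
From mathcomp Require Import all_boot all_order all_algebra.
From mathcomp Require Import all_classical all_reals all_analysis.
From mathcomp Require Import ring lra zify.
From mathcomp Require measurable_realfun.
Import Order.TTheory GRing.Theory Num.Theory.
Import numFieldNormedType.Exports.
Local Open Scope classical_set_scope.
Local Open Scope ring_scope.

(** Derivative bounds are expressed by majorants.  A majorant is a function on lists of
    coordinates (a list is a mixed derivative); lists with the shuffle product form a
    commutative ring with derivations [shD j], i.e. exponential generating series.
    With [z] the linear (resp. [sum_j beta_j (exp (2 pi x_j) - 1)]) majorant of the first
    layer, layer [l] is majorized by [P_l z / (1 - S_l z)]: composing with [sigma], whose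
    majorant is [xi / (1 - tau x)], sends [a z / (1 - c z)] to
    [xi tau a z / (1 - (c + tau a) z)].  Hence both [G] and the network are majorized by
    [C / (1 - sum_j b_j psi_j)] and the squared difference by [4 C^2] times the square of
    this geometric series.  The derivatives of these series at 0 are the stated bounds; in
    the periodic case Stirling numbers come from substituting [exp (2 pi x) - 1].

    The Sobolev bounds follow pointwise.  For the Korobov norm, integration by parts is
    replaced by half-period shifts: [F^(h)] is [2^-N] times the Fourier coefficient of an
    [N]-fold finite difference of [F] with steps [1 / (2 |h_j|)], which the mean value
    theorem bounds by the derivative of [F]. *)

(** * The shuffle algebra *)

(** A name of its own for [seq I -> R]: its multiplication is to be the shuffle product and not the
    pointwise one, so only the additive structure is taken over. *)
Definition shuf (R : realType) (I : eqType) := seq I -> R.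
HB.instance Definition _ R I := GRing.Zmodule.on (shuf R I).

Definition shD {R : realType} {I : eqType} (j : I) (f : shuf R I) : shuf R I :=
  fun r => f (j :: r).

(** The recursion is the Leibniz rule, which makes [shD j] a derivation by computation. Unfolded,
    the value at [r] is the sum of [f r1 * g r2] over all ways to distribute the entries of [r] over
    two complementary subsequences [r1] and [r2]. *)
Fixpoint shmul {R : realType} {I : eqType} (f g : shuf R I) (r : seq I) : R :=
  if r is j :: r' then shmul (shD j f) g r' + shmul f (shD j g) r'
  else f [::] * g [::].

Definition cst_shuf {R : realType} {I : eqType} (c : R) : shuf R I :=
  fun r => if r is [::] then c else 0.

Section ShuffleRing.
Context {R : realType} {I : eqType}.
Implicit Types (f g h : shuf R I) (j : I) (r : seq I).

Lemma shufP f g : (forall r, f r = g r) <-> f = g.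
Proof. by split=> [fg|->//]; apply/funext. Qed.

Lemma shaddE f g r : (f + g) r = f r + g r. Proof. by []. Qed.
Lemma shDD j f g : shD j (f + g) = shD j f + shD j g. Proof. by []. Qed.
Lemma shDN j f : shD j (- f) = - shD j f. Proof. by []. Qed.
Lemma shD_cst j (c : R) : shD j (cst_shuf c : shuf R I) = 0. Proof. by []. Qed.

Lemma shmulC : commutative (@shmul R I).
Proof.
move=> f g; apply/shufP => r; elim: r f g => [|j r IH] f g /=; first exact: mulrC.
by rewrite addrC (IH f) (IH _ g).
Qed.

Lemma shmulDl : left_distributive (@shmul R I) +%R.
Proof.
move=> f g h; apply/shufP => r; elim: r f g h => [|j r IH] f g h /=; first exact: mulrDl.
by rewrite shDD !IH addrACA.
Qed.

Lemma shmulD j f g : shD j (shmul f g) = shmul (shD j f) g + shmul f (shD j g).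
Proof. by []. Qed.

Lemma shmulA : associative (@shmul R I).
Proof.
move=> f g h; apply/shufP => r; elim: r f g h => [|j r IH] f g h /=; first exact: mulrA.
have shmulDr (u v w : shuf R I) : shmul u (v + w) = shmul u v + shmul u w.
  by rewrite shmulC shmulDl !(shmulC u).
by rewrite !shmulD shmulDr shmulDl [X in _ + X = _]shaddE [X in _ = X + _]shaddE !IH addrA.
Qed.

Lemma shmul1 : left_id (cst_shuf 1 : shuf R I) shmul.
Proof.
move=> f; apply/shufP => r; elim: r f => [|j r IH] f /=; first exact: mul1r.
rewrite IH shD_cst [X in X + _](_ : _ = 0) ?add0r//.
(* The ring structure is still under construction, so [0 * f = 0] is derived from distributivity by
   cancellation. *)
have /(congr1 (@^~ r)) : shmul 0 f = 0; last by [].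
by apply: (@addrI _ (shmul 0 f)); rewrite -shmulDl !addr0.
Qed.

Lemma sh_oner_neq0 : (cst_shuf 1 : shuf R I) != 0.
Proof. by apply/eqP => /(congr1 (@^~ [::])) /eqP; rewrite /= oner_eq0. Qed.

End ShuffleRing.

HB.instance Definition _ R I := GRing.Zmodule_isComNzRing.Build (shuf R I)
  (@shmulA R I) (@shmulC R I) (@shmul1 R I) (@shmulDl R I) (@sh_oner_neq0 R I).

Section ShuffleTheory.
Context {R : realType} {I : eqType}.
Implicit Types (f g h z : shuf R I) (j : I) (r : seq I) (c : R).

Lemma shE_cons f g j r : (f * g) (j :: r) = (shD j f * g) r + (f * shD j g) r.
Proof. by []. Qed.
Lemma shE_nil f g : (f * g) [::] = f [::] * g [::]. Proof. by []. Qed.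
Lemma sh1_nil : (1 : shuf R I) [::] = 1. Proof. by []. Qed.
Lemma shoppE f r : (- f) r = - f r. Proof. by []. Qed.

Lemma shDM j f g : shD j (f * g) = shD j f * g + f * shD j g. Proof. by []. Qed.
Lemma shD1 j : shD j (1 : shuf R I) = 0. Proof. by []. Qed.

Lemma shX_nil f n : (f ^+ n) [::] = f [::] ^+ n.
Proof. by elim: n => [|n IH]; rewrite ?expr0// !exprS shE_nil IH. Qed.

Lemma shDX j f n : shD j (f ^+ n.+1) = n.+1%:R * f ^+ n * shD j f.
Proof.
elim: n => [|n IH]; first by rewrite expr1 expr0 !mul1r.
by rewrite exprS shDM IH exprS -[n.+2]addn1 natrD; ring.
Qed.

Fact cst_shuf_additive : zmod_morphism (cst_shuf : R -> shuf R I).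
Proof. by move=> a b; apply/shufP => -[|j r]; rewrite shaddE shoppE //= subr0. Qed.
Fact cst_shuf_multiplicative : monoid_morphism (cst_shuf : R -> shuf R I).
Proof.
split=> // a b; apply/shufP => -[|j r] //=.
by rewrite shE_cons !shD_cst mul0r mulr0 addr0.
Qed.
HB.instance Definition _ := GRing.isZmodMorphism.Build R (shuf R I) cst_shuf cst_shuf_additive.
HB.instance Definition _ := GRing.isMonoidMorphism.Build R (shuf R I) cst_shuf cst_shuf_multiplicative.

Lemma cst_shufM c f r : (cst_shuf c * f) r = c * f r.
Proof.
by elim: r f => [|j r IH] f //; rewrite shE_cons shD_cst mul0r add0r IH.
Qed.

Lemma shDcM j c f : shD j (cst_shuf c * f) = cst_shuf c * shD j f.
Proof. by rewrite shDM shD_cst mul0r add0r. Qed.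

Lemma shsumE (J : Type) (s : seq J) (P : pred J) (F : J -> shuf R I) r :
  (\sum_(i <- s | P i) F i) r = \sum_(i <- s | P i) F i r.
Proof. by elim/big_rec2 : _ => // i x y _ <-. Qed.

Lemma shD_sum (J : Type) (s : seq J) (P : pred J) (F : J -> shuf R I) j :
  shD j (\sum_(i <- s | P i) F i) = \sum_(i <- s | P i) shD j (F i).
Proof. by elim/big_rec2 : _ => // i x y _ <-. Qed.

Definition shle f g := forall r, f r <= g r.

Lemma shmul_ge0 f g : shle 0 f -> shle 0 g -> shle 0 (f * g).
Proof.
move=> + + r; elim: r f g => [|j r IH] f g f0 g0; first exact: mulr_ge0 (f0 _) (g0 _).
by apply: addr_ge0; apply: (IH _ _) => // r1; [exact: (f0 (j :: r1))|exact: (g0 (j :: r1))].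
Qed.

Lemma shX_ge0 f n : shle 0 f -> shle 0 (f ^+ n).
Proof.
by move=> f0; elim: n => [|n IH]; [case=> //= ; rewrite ?ler01|rewrite exprS; apply: shmul_ge0].
Qed.

Lemma cst_shuf_ge0 c : 0 <= c -> shle 0 (cst_shuf c). Proof. by move=> c0 []. Qed.

Lemma shsum_ge0 (J : Type) (s : seq J) (P : pred J) (F : J -> shuf R I) :
  (forall i, P i -> shle 0 (F i)) -> shle 0 (\sum_(i <- s | P i) F i).
Proof. by move=> F0 r; rewrite shsumE; apply: sumr_ge0 => i Pi; apply: F0. Qed.

(** Order of vanishing: a factor without constant term raises it by one. After one derivative,
    either it fell on [z], and [g] vanishes far enough, or it fell on [g] and cost one order, which
    induction makes up for. *)
Lemma shmul_low z g n : z [::] = 0 -> (forall r, (size r < n)%N -> g r = 0) ->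
  forall r, (size r < n.+1)%N -> (z * g) r = 0.
Proof.
move=> + + r; elim: r z g n => [|j r IH] z g n z0 gn rn; first by rewrite shE_nil z0 mul0r.
have below f g' m : (forall r, (size r < m)%N -> g' r = 0) ->
    forall r, (size r < m)%N -> (f * g') r = 0.
  move=> + r'; elim: r' f g' m {rn} => [|i r' IH'] f g' m g'0 r'm.
    by rewrite shE_nil g'0// mulr0.
  rewrite shE_cons (IH' _ _ m)// ?add0r; last exact: ltnW.
  by apply: (IH' _ _ m.-1) => [r1 r1m|]; [apply: g'0 => /=; lia|move: r'm => /=; lia].
rewrite shE_cons (below _ _ n)// add0r.
case: n => [|n] in gn rn *; first by [].
by apply: (IH _ _ n) => // r' r'n; apply: gn.
Qed.

Lemma shX_low z n : z [::] = 0 -> forall r, (size r < n)%N -> (z ^+ n) r = 0.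
Proof. by move=> z0; elim: n => [|n IH] r rn //; rewrite exprS (@shmul_low _ _ n). Qed.

Lemma shmul_eq_upto n f g g' : (forall r, (size r <= n)%N -> g r = g' r) ->
  forall r, (size r <= n)%N -> (f * g) r = (f * g') r.
Proof.
move=> + r; elim: r f g g' n => [|j r IH] f g g' n gg' rn; first by rewrite !shE_nil gg'.
rewrite !shE_cons; congr (_ + _); first by apply: (IH _ _ _ n) => //; apply: ltnW.
by apply: (IH _ _ _ n.-1) => [r' r'n|]; [apply: gg' => /=; move: rn => /=; lia|move: rn => /=; lia].
Qed.

(** The geometric series [1 / (1 - z)] without a limit: if [z] has no constant term, the powers
    beyond [size r] vanish at [r], so the truncation is exact. *)
Definition geo z : shuf R I := fun r => (\sum_(k < (size r).+1) z ^+ k) r.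

Lemma geo_upto z n r : z [::] = 0 -> (size r <= n)%N ->
  geo z r = (\sum_(k < n.+1) z ^+ k) r.
Proof.
move=> z0 rn; rewrite /geo !shsumE (big_ord_widen n.+1 (fun k => (z ^+ k) r))//.
rewrite [RHS](bigID (fun k : 'I__ => (k < (size r).+1)%N))/= [X in _ + X]big1 ?addr0//.
by move=> k; rewrite -leqNgt => rk; apply: shX_low.
Qed.

Lemma geoM z : z [::] = 0 -> (1 - z) * geo z = 1.
Proof.
move=> z0; apply/shufP => r.
have -> : ((1 - z) * geo z) r = ((1 - z) * \sum_(k < (size r).+1) z ^+ k) r.
  by apply: (@shmul_eq_upto (size r)) => // r' r'r; apply: geo_upto.
by rewrite -opprB mulNr -subrX1 opprB shaddE shoppE shX_low// oppr0 addr0.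
Qed.

Lemma geo_nil z : geo z [::] = 1.
Proof. by rewrite /geo big_ord_recl big_ord0 addr0 expr0. Qed.

(** Differentiate [(1 - z) * geo z = 1] and multiply by [geo z]. *)
Lemma shD_geo z j : z [::] = 0 -> shD j (geo z) = geo z ^+ 2 * shD j z.
Proof.
move=> z0; have zK := geoM _ z0.
have E : (1 - z) * shD j (geo z) = shD j z * geo z.
  have := congr1 (shD j) zK; rewrite shDM shDD shDN shD1 add0r => /eqP.
  by rewrite mulNr addrC subr_eq0 => /eqP.
rewrite -[LHS]mul1r -zK mulrAC E; ring.
Qed.

Lemma geo_ge0 z : shle 0 z -> shle 0 (geo z).
Proof. by move=> z0 r; apply: shsum_ge0 => k _; apply: shX_ge0. Qed.

End ShuffleTheory.

(** * Stirling numbers and geometric majorants *)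

Section Stirling.
Context {R : realType}.

(** This is [k!] times the Stirling number, the number of surjections from [n] points onto [k]
    points, by the explicit formula without case distinctions. The recurrence is proved in this
    form. *)
Let altsum (n k : nat) : R :=
  \sum_(i < k.+1) (-1) ^+ (k - i) * 'C(k, i)%:R * (i%:R) ^+ n.

Let altsum0 k : altsum 0 k = (k == 0%N)%:R.
Proof.
have := exprDn (-1 : R) 1 k; rewrite addNr expr0n => ->.
by apply: eq_bigr => i _; rewrite expr1n expr0 !mulr1 mulr_natr.
Qed.

Let altsumS0 n : altsum n.+1 0 = 0.
Proof. by rewrite /altsum big_ord1 expr0n/= mulr0. Qed.

Let altsumSS n k : altsum n.+1 k.+1 = k.+1%:R * (altsum n k.+1 + altsum n k).
Proof.
(* For [i >= 1] both sides are [k + 1] times the binomial coefficient of [k] over [i - 1]. This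
   splits one factor [i] of [i ^ (n + 1)] so that the two alternating sums on the right appear. *)
have absorb i : i%:R * 'C(k.+1, i)%:R = k.+1%:R * 'C(k.+1, i)%:R - k.+1%:R * 'C(k, i)%:R :> R.
  apply/eqP; rewrite eq_sym subr_eq -!natrM -natrD eqr_nat; apply/eqP.
  case: i => [|i]; first by rewrite !bin0.
  by rewrite -mul_bin_diag -mulnDr binS addnC.
have -> : altsum n k = - \sum_(i < k.+2) (-1) ^+ (k.+1 - i) * 'C(k, i)%:R * (i%:R) ^+ n.
  rewrite big_ord_recr/= bin_small// mulr0 mul0r addr0 -sumrN.
  by apply: eq_bigr => i _; rewrite subSn ?leq_ord// exprS mulN1r !mulNr opprK.
rewrite /altsum -sumrB mulr_sumr; apply: eq_bigr => i _.
rewrite exprS mulrA -(mulrA (_ ^+ _)) (mulrC _ i%:R) absorb; ring.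
Qed.

Let altsum_small n k : (n < k)%N -> altsum n k = 0.
Proof.
elim: n k => [|n IH] [|k]// nk.
by rewrite altsumSS !IH ?addr0 ?mulr0//; lia.
Qed.

Let stirling2E n k : stirling2 n k = (k`!%:R)^-1 * altsum n k.
Proof.
rewrite /stirling2; case: eqP => [->|_].
  by case: n => [|n]; rewrite ?altsum0 ?altsumS0 ?mulr0// fact0 invr1 mul1r.
by case: ifP => [nk|//]; rewrite altsum_small// mulr0.
Qed.

Lemma stirling2_small n k : (n < k)%N -> stirling2 n k = 0 :> R.
Proof. by move=> nk; rewrite stirling2E altsum_small// mulr0. Qed.

Lemma stirling2_S0 n : stirling2 n.+1 0 = 0 :> R. Proof. by []. Qed.

Lemma stirling2_SS n k :
  stirling2 n.+1 k.+1 = k.+1%:R * stirling2 n k.+1 + stirling2 n k :> R.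
Proof.
rewrite !stirling2E altsumSS factS natrM.
have k0 : k.+1%:R != 0 :> R by rewrite pnatr_eq0.
have kf0 : k`!%:R != 0 :> R by rewrite pnatr_eq0 -lt0n fact_gt0.
by field; rewrite kf0 addrC -(natrD _ k 1) addn1 k0.
Qed.

End Stirling.

(** * Factorials of the total degree as a linear functional on polynomials *)

Section FactorialFunctional.
Context {R : realType}.
Implicit Types p q : {poly R}.

(** The linear functional sending ['X^i] to [(i + k)!], formally integration against [t^k exp(-t)]
    over the half line. It encodes sums over multi-indices weighted by [(|m| + k)!] as values on
    products of one-variable polynomials. *)
Definition factfun (k : nat) p : R := \sum_(i < size p) p`_i * (i + k)`!%:R.

Lemma factfun_wide N k p : (size p <= N)%N ->
  factfun k p = \sum_(i < N) p`_i * (i + k)`!%:R.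
Proof.
move=> pN; rewrite /factfun (big_ord_widen N (fun i => p`_i * (i + k)`!%:R))//.
rewrite [RHS](bigID (fun i : 'I__ => (i < size p)%N))/= [X in _ = _ + X]big1 ?addr0//.
by move=> i; rewrite -leqNgt => ip; rewrite nth_default// mul0r.
Qed.

Lemma factfunD k p q : factfun k (p + q) = factfun k p + factfun k q.
Proof.
set N := maxn (size p) (size q).
rewrite !(@factfun_wide N) ?leq_maxl ?leq_maxr ?size_polyD// -big_split.
by apply: eq_bigr => i _; rewrite coefD mulrDl.
Qed.

Lemma factfunZ k c p : factfun k (c *: p) = c * factfun k p.
Proof.
rewrite !(@factfun_wide (size p)) ?size_scale_leq// mulr_sumr.
by apply: eq_bigr => i _; rewrite coefZ mulrA.
Qed.

Lemma factfun_sum k (J : Type) (s : seq J) (P : pred J) (F : J -> {poly R}) :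
  factfun k (\sum_(i <- s | P i) F i) = \sum_(i <- s | P i) factfun k (F i).
Proof.
elim/big_rec2 : _ => [|i x y _ <-]; last by rewrite factfunD.
by rewrite /factfun size_poly0 big_ord0.
Qed.

Lemma factfunX k n : factfun k 'X^n = (n + k)`!%:R.
Proof.
rewrite /factfun size_polyXn big_ord_recr/= big1 ?add0r ?coefXn ?eqxx ?mul1r// => i _.
by rewrite coefXn ltn_eqF// mul0r.
Qed.

Lemma factfunXM k m p : factfun k ('X^m * p) = factfun (m + k) p.
Proof.
have -> : p = \sum_(i < size p) p`_i *: 'X^i by rewrite -poly_def coefK.
rewrite mulr_sumr !factfun_sum; apply: eq_bigr => i _.
by rewrite -scalerAr !factfunZ -exprD !factfunX addnA (addnC m).
Qed.

(** The Touchard polynomial of degree [n], taken at [c 'X]. *)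
Definition touchard (n : nat) (c : R) : {poly R} :=
  \sum_(m < n.+1) (stirling2 n m * c ^+ m) *: 'X^m.

Lemma touchard_wide N n c : (n <= N)%N ->
  touchard n c = \sum_(m < N.+1) (stirling2 n m * c ^+ m) *: 'X^m.
Proof.
move=> nN; rewrite /touchard.
rewrite (big_ord_widen N.+1 (fun m => (stirling2 n m * c ^+ m) *: 'X^m))//.
rewrite [RHS](bigID (fun i : 'I__ => (i < n.+1)%N))/= [X in _ = _ + X]big1 ?addr0//.
by move=> i; rewrite -leqNgt => ip; rewrite stirling2_small// mul0r scale0r.
Qed.

(** Expand the product over all choices of one monomial per factor. A common range [N] serves all
    factors because the Stirling numbers vanish beyond [nu i]. *)
Lemma factfun_prod_touchard (I : finType) (nu : I -> nat) (c : I -> R) k N :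
  (forall i, (nu i <= N)%N) ->
  factfun k (\prod_i touchard (nu i) (c i)) =
  \sum_(m : {ffun I -> 'I_N.+1})
    ((\sum_i m i) + k)`!%:R * (\prod_i stirling2 (nu i) (m i)) * \prod_i c i ^+ m i.
Proof.
move=> nuN.
under eq_bigr do rewrite (touchard_wide N _ _ (nuN _)).
rewrite (bigA_distr_bigA (fun i (m : 'I_N.+1) => (stirling2 (nu i) m * c i ^+ m) *: 'X^m)).
rewrite factfun_sum; apply: eq_bigr => m _.
rewrite scaler_prod factfunZ -expr_sum factfunX big_split/=.
ring.
Qed.

End FactorialFunctional.

Definition blocks {I : Type} (nu : I -> nat) (js : seq I) : seq I :=
  flatten [seq nseq (nu j) j | j <- js].

(** * Exponential series in single coordinates and powers of the geometric series *)

Section CoordinateMajorants.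
Context {R : realType} {I : finType}.
Implicit Types (kappa : nat -> R) (b : I -> R) (i j : I) (r : seq I).

(** The series [sum_(n >= 1) kappa n * x_i ^ n / n!] in the variable [x_i]. *)
Definition coord_maj kappa i : shuf R I :=
  fun r => if (0 < size r)%N && all (pred1 i) r then kappa (size r) else 0.

Definition lin_maj b kappa : shuf R I := \sum_i cst_shuf (b i) * coord_maj kappa i.

(** The series [k! / (1 - z)^(k+1)], the [k]-th derivative of [1 / (1 - z)] with respect to [z]. By
    the chain rule each [shD] raises [k] by one and multiplies by a derivative of [z]. *)
Definition geo_pow b kappa k : shuf R I :=
  cst_shuf k`!%:R * geo (lin_maj b kappa) ^+ k.+1.

Lemma lin_maj_nil b kappa : lin_maj b kappa [::] = 0.
Proof. by rewrite /lin_maj shsumE big1// => i _; rewrite cst_shufM mulr0. Qed.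

Lemma lin_majE b kappa j r :
  lin_maj b kappa (j :: r) = b j * (if all (pred1 j) r then kappa (size r).+1 else 0).
Proof.
rewrite /lin_maj shsumE (bigD1 j)//= big1 ?addr0 => [|i ij].
  by rewrite cst_shufM /coord_maj/= eqxx.
by rewrite cst_shufM /coord_maj/= eq_sym (negbTE ij) mulr0.
Qed.

Lemma lin_maj_ge0 b kappa : (forall i, 0 <= b i) -> (forall n, 0 <= kappa n) ->
  shle 0 (lin_maj b kappa).
Proof.
move=> b0 k0; apply: shsum_ge0 => i _; apply: shmul_ge0; first exact: cst_shuf_ge0.
by move=> r; rewrite /coord_maj; case: ifP.
Qed.

Lemma geo_pow_nil b kappa k : geo_pow b kappa k [::] = k`!%:R.
Proof. by rewrite /geo_pow cst_shufM shX_nil geo_nil expr1n mulr1. Qed.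

Lemma shD_geo_pow b kappa k j :
  shD j (geo_pow b kappa k) = shD j (lin_maj b kappa) * geo_pow b kappa k.+1.
Proof.
rewrite /geo_pow shDcM shDX shD_geo ?lin_maj_nil// factS natrM rmorphM rmorph_nat.
by rewrite !exprS; ring.
Qed.

Lemma shD_lin_maj1 b j : shD j (lin_maj b (fun n => (n == 1%N)%:R)) = cst_shuf (b j).
Proof.
by apply/shufP => -[|i r]; rewrite /shD lin_majE /= ?mulr1//; case: ifP; rewrite mulr0.
Qed.

Lemma geo_pow1E b k r : geo_pow b (fun n => (n == 1%N)%:R) k r =
  (size r + k)`!%:R * \prod_(j <- r) b j.
Proof.
elim: r k => [|j r IH] k; first by rewrite geo_pow_nil big_nil mulr1.
rewrite -[LHS]/(shD j (geo_pow _ _ k) r) shD_geo_pow shD_lin_maj1 cst_shufM IH.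
by rewrite big_cons/= addnS; ring.
Qed.

(** For [kappa n = w ^ n] the series is [e = exp (w x_i) - 1], which satisfies [e' = w (1 + e)]. *)
Lemma shD_coord_maj_exp w i j : shD j (coord_maj (fun n => w ^+ n) i) =
  if i == j then cst_shuf w * (1 + coord_maj (fun n => w ^+ n) i) else 0.
Proof.
apply/shufP => r; rewrite /shD/= /coord_maj/= (eq_sym j); case: eqP => //= _.
rewrite cst_shufM shaddE; case: r => [|k r] /=; first by rewrite addr0 mulr1.
by rewrite add0r; case: ifP; rewrite ?mulr0// exprS.
Qed.

Lemma shD_lin_maj_exp w b j : shD j (lin_maj b (fun n => w ^+ n)) =
  cst_shuf (w * b j) * (1 + coord_maj (fun n => w ^+ n) j).
Proof.
rewrite /lin_maj shD_sum (bigD1 j)//= big1 ?addr0 => [|i /negbTE ij].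
  by rewrite shDcM shD_coord_maj_exp eqxx rmorphM/=; ring.
by rewrite shDcM shD_coord_maj_exp ij mulr0.
Qed.

(** The series [b_j^m exp (m w x_j) (k + m)! / (1 - z)^(k + m + 1)]. Up to the factor [w], its
    derivative in [x_j] is [m] times itself plus the next term, which is the recurrence behind the
    Stirling numbers. *)
Let term w b j k m : shuf R I := cst_shuf (b j ^+ m) *
  (1 + coord_maj (fun n => w ^+ n) j) ^+ m * geo_pow b (fun n => w ^+ n) (k + m).

Let shD_term w b j k m : shD j (term w b j k m) =
  cst_shuf w * (m%:R * term w b j k m + term w b j k m.+1).
Proof.
rewrite /term -mulrA shDcM shDM shD_geo_pow shD_lin_maj_exp addnS.
case: m => [|m]; first by rewrite !expr0 shD1 expr1 !rmorphM/= rmorph1; ring.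
rewrite shDX shDD shD1 add0r shD_coord_maj_exp eqxx !exprS !rmorphM/=.
ring.
Qed.

(** The factor [X] collects what does not depend on [x_j]. The coefficients of [n] derivatives in
    [x_j] obey the Stirling recurrence, by the derivative rule for [term]. *)
Let iter_term w b j k n X : shD j X = 0 ->
  iter n (shD j) (X * geo_pow b (fun n => w ^+ n) k) =
  \sum_(m < n.+1) cst_shuf (w ^+ n * stirling2 n m) * (X * term w b j k m).
Proof.
move=> X0; elim: n => [|n IH].
  by rewrite big_ord1 mulr1 rmorph1 mul1r /term !expr0 rmorph1 !mul1r addn0.
rewrite iterS IH shD_sum.
under eq_bigr => m _ do rewrite shDcM shDM X0 mul0r add0r shD_term.
have -> : \sum_(m < n.+1) cst_shuf (w ^+ n * stirling2 n m) *
    (X * (cst_shuf w * (m%:R * term w b j k m + term w b j k m.+1))) =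
  \sum_(m < n.+1) cst_shuf (w ^+ n.+1 * (m%:R * stirling2 n m)) * (X * term w b j k m) +
  \sum_(m < n.+1) cst_shuf (w ^+ n.+1 * stirling2 n m) * (X * term w b j k m.+1).
  rewrite -big_split; apply: eq_bigr => m _ /=.
  by rewrite !exprS !rmorphM/= rmorph_nat; ring.
rewrite [in RHS]big_ord_recl stirling2_S0 mulr0 rmorph0 mul0r add0r.
rewrite [X in X + _](_ : _ = \sum_(m < n.+1)
    cst_shuf (w ^+ n.+1 * (m.+1%:R * stirling2 n m.+1)) * (X * term w b j k m.+1)).
  rewrite -big_split; apply: eq_bigr => m _; rewrite stirling2_SS mulrDr rmorphD mulrDl.
  by [].
(* The two sums match after an index shift: the left one starts with the factor [m = 0], the right
   one ends with the Stirling number of [n] and [n + 1], which is [0]. *)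
rewrite big_ord_recl/= mul0r mulr0 rmorph0 mul0r add0r big_ord_recr/=.
by rewrite [in RHS]stirling2_small// mulr0 mulr0 rmorph0 mul0r addr0.
Qed.

Let shE_nseq f n j r : (f : shuf R I) (nseq n j ++ r) = iter n (shD j) f r.
Proof. by elim: n f => [|n IH] f //=; rewrite -iterS iterSr -IH. Qed.

(** Each block of [nu j] derivatives contributes one Touchard polynomial: the power [b_j^m] comes
    with a shift of [k] by [m], and [factfun] records this shift as multiplication by ['X^m]. *)
Lemma geo_pow_blocks w b k (nu : I -> nat) js : uniq js ->
  geo_pow b (fun n => w ^+ n) k (blocks nu js) =
  w ^+ (\sum_(j <- js) nu j) * factfun k (\prod_(j <- js) touchard (nu j) (b j)).
Proof.
(* The exponential factors left by the earlier blocks are kept in [X]. They do not depend on the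
   remaining variables, since [js] has no repetition, and each equals [1] at the origin. *)
have gen X : uniq js -> (forall j, j \in js -> shD j X = 0) ->
    (X * geo_pow b (fun n => w ^+ n) k) (blocks nu js) =
    X [::] * (w ^+ (\sum_(j <- js) nu j) *
             factfun k (\prod_(j <- js) touchard (nu j) (b j))).
  elim: js k X => [|j js IH] k X /=.
    by rewrite !big_nil expr0 mul1r -(expr0 'X) factfunX shE_nil geo_pow_nil.
  move=> /andP[jjs ujs] X0; rewrite [blocks _ _]/(nseq (nu j) j ++ blocks nu js).
  rewrite shE_nseq iter_term; last by apply: X0; rewrite mem_head.
  rewrite shsumE !big_cons.
  rewrite [touchard (nu j) _]/touchard mulr_suml factfun_sum !mulr_sumr.
  apply: eq_bigr => m _; rewrite cst_shufM /term (mulrA X) IH//; last first.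
    move=> i ijs; rewrite shDM shDcM X0 ?inE ?ijs ?orbT//.
    have ij : (j == i) = false by apply: contraNF jjs => /eqP ->.
    case: (val m) => [|p]; first by rewrite shD1 !(mul0r,mulr0,addr0).
    by rewrite shDX shDD shD1 shD_coord_maj_exp ij !(mul0r,mulr0,addr0).
  rewrite !shE_nil shX_nil shaddE sh1_nil [coord_maj _ _ _]/= addr0 expr1n mulr1.
  rewrite -[X in factfun k X]scalerAl factfunZ factfunXM addnC exprD /=; ring.
move=> ujs; rewrite -[geo_pow _ _ _]mul1r gen ?mul1r// => j _; exact: shD1.
Qed.

End CoordinateMajorants.

(** * The series coefficients are the bounds of the statement *)

Section Bounds.
Context {R : realType} {s : nat}.
Implicit Types (b : nat -> R) (nu : 'I_s -> nat) (u : {set 'I_s}).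

Definition coordb b (j : 'I_s) : R := b (nat_of_ord j).+1.

Definition kap_id (n : nat) : R := (n == 1%N)%:R.
Definition kap_sin (n : nat) : R := (2 * pi) ^+ n.

(** The head of a list is the innermost derivative, whereas [dnu] applies the
    derivatives in the last coordinate first. *)
Definition mblocks nu : seq 'I_s := blocks nu (rev (enum 'I_s)).

Definition ind_idx (a : nat) u (j : 'I_s) : nat := if j \in u then a else 0%N.

Lemma big_rev_enum (T : Type) (idx : T) (op : Monoid.com_law idx) (F : 'I_s -> T) :
  \big[op/idx]_(j <- rev (enum 'I_s)) F j = \big[op/idx]_j F j.
Proof. by rewrite (perm_big (enum 'I_s)) ?perm_rev//= big_enum. Qed.

Lemma size_mblocks nu : size (mblocks nu) = nabs nu.
Proof.
rewrite /mblocks /blocks size_flatten /shape -map_comp sumnE big_map.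
rewrite big_rev_enum; apply: eq_bigr => j _ /=; exact: size_nseq.
Qed.

Lemma prod_mblocks nu (F : 'I_s -> R) :
  \prod_(j <- mblocks nu) F j = \prod_j F j ^+ nu j.
Proof.
rewrite /mblocks /blocks big_flatten big_map big_rev_enum.
by apply: eq_bigr => j _; rewrite big_nseq iter_mulr_1.
Qed.

Lemma geo_pow_boundA C b nu :
  C * geo_pow (coordb b) kap_id 0 (mblocks nu) = boundA C b nu.
Proof. by rewrite geo_pow1E size_mblocks addn0 prod_mblocks mulrA. Qed.

Lemma nabs_ind a u : nabs (ind_idx a u) = (a * #|u|)%N.
Proof. by rewrite /nabs /ind_idx -big_mkcond/= sum_nat_const mulnC. Qed.

Lemma geo_pow_ind1 b k u :
  geo_pow (coordb b) kap_id k (mblocks (ind_idx 1 u)) =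
  (#|u| + k)`!%:R * \prod_(j in u) b (nat_of_ord j).+1.
Proof.
rewrite geo_pow1E size_mblocks prod_mblocks nabs_ind mul1n [in RHS]big_mkcond/=.
by congr (_ * _); apply: eq_bigr => j _; rewrite /ind_idx; case: ifP.
Qed.

Lemma geo_pow_sin b k nu : geo_pow (coordb b) kap_sin k (mblocks nu) =
  (2 * pi) ^+ nabs nu * factfun k (\prod_j touchard (nu j) (coordb b j)).
Proof.
rewrite geo_pow_blocks ?rev_uniq ?enum_uniq// !big_rev_enum//.
Qed.

Lemma geo_pow_boundB C b nu :
  C * geo_pow (coordb b) kap_sin 0 (mblocks nu) = boundB C b nu.
Proof.
rewrite geo_pow_sin mulrA; congr (_ * _).
have nuN j : (nu j <= \max_(j : 'I_s) nu j)%N by exact: leq_bigmax.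
rewrite (factfun_prod_touchard _ _ _ _ _ nuN) [RHS]big_mkcond; apply: eq_bigr => m _ /=.
case: ifPn => [_|/forallPn [j]]; first by rewrite addn0 mulrAC.
rewrite -ltnNge => mj.
by rewrite [X in _ * X * _](bigD1 j)//= stirling2_small// !(mul0r,mulr0).
Qed.

Lemma factfun_sumK b a u k :
  factfun k (\prod_j touchard (ind_idx a u j) (coordb b j)) = sumK b a u k.
Proof.
have aN j : (ind_idx a u j <= a)%N by rewrite /ind_idx; case: ifP.
rewrite (factfun_prod_touchard _ _ _ _ _ aN) /sumK [RHS]big_mkcond.
apply: eq_bigr => m _ /=.
case: ifPn => [/forallP m0|/forallPn [j]].
  have mu j : j \notin u -> m j = ord0 by move=> ju; apply/eqP; exact: (implyP (m0 j)).
  congr (_`!%:R * _ * _).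
  - congr addn; rewrite [RHS]big_mkcond; apply: eq_bigr => j _.
    by case: ifPn => // /mu ->.
  - rewrite [RHS]big_mkcond; apply: eq_bigr => j _; rewrite /ind_idx.
    by case: ifPn => // /mu ->.
  - rewrite [RHS]big_mkcond; apply: eq_bigr => j _.
    by case: ifPn => // /mu ->; rewrite expr0.
rewrite negb_imply => /andP[ju mj0].
rewrite [X in _ * X * _](bigD1 j)//= {1}/ind_idx (negbTE ju) stirling2_small ?lt0n//.
by rewrite !(mul0r,mulr0).
Qed.

Lemma geo_pow_sumK b a u k :
  geo_pow (coordb b) kap_sin k (mblocks (ind_idx a u)) =
  (2 * pi) ^+ (a * #|u|) * sumK b a u k.
Proof. by rewrite geo_pow_sin nabs_ind factfun_sumK. Qed.

End Bounds.

(** * Partial derivatives and majorants of compositions *)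

Section PartialDerivatives.
Context {R : realType} {s : nat}.
Implicit Types (F G : 'rV[R]_s -> R) (y : 'rV[R]_s) (j : 'I_s) (r : seq 'I_s).

(** The head of the list is differentiated first, so that [pdr (j :: r) F] unfolds to
    [pdr r (pd j F)], in step with [shD j] on majorants; [pds] uses the opposite order. *)
Definition pdr r F : 'rV[R]_s -> R := foldl (fun H j => pd j H) F r.

Lemma pdD F G j y : derivable F y (ev j) -> derivable G y (ev j) ->
  pd j (fun x => F x + G x) y = pd j F y + pd j G y.
Proof. exact: deriveD. Qed.

Lemma pdB F G j y : derivable F y (ev j) -> derivable G y (ev j) ->
  pd j (fun x => F x - G x) y = pd j F y - pd j G y.
Proof. exact: deriveB. Qed.

Lemma pdM F G j y : derivable F y (ev j) -> derivable G y (ev j) ->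
  pd j (fun x => F x * G x) y = pd j F y * G y + F y * pd j G y.
Proof.
move=> dF dG; apply: (etrans (deriveM dF dG)).
by rewrite addrC; congr (_ + _); exact: mulrC.
Qed.

Lemma is_derive_line F y j t : derivable F (t *: ev j + y) (ev j) ->
  is_derive t 1 (fun h : R => F (h *: ev j + y)) (pd j F (t *: ev j + y)).
Proof.
rewrite /derivable /pd /derive.
set g1 := fun h => h^-1 *: _; move=> d1.
have E : (fun h : R => h^-1 *: (((fun h0 : R => F (h0 *: ev j + y)) \o shift t) (h *: (1 : R^o)) -
    F (t *: ev j + y))) = g1.
  by apply/funext => h; rewrite /g1/= scalerDl addrA [h *: 1]mulr1.
by apply: DeriveDef; rewrite /derivable /derive E.
Qed.

(** Only the derivative of [F] in the direction [ev j] is assumed, so the chain rule is applied to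
    the restriction of [F] to the line through [y]. *)
Lemma is_derive_comp_line (sigma : R -> R) F j y :
  derivable sigma (F y) 1 -> derivable F y (ev j) ->
  is_derive y (ev j) (sigma \o F) (derive1 sigma (F y) * pd j F y).
Proof.
move=> ds dF.
have line0 G : derivable G y (ev j) ->
    is_derive (0 : R) 1 (fun h : R => G (h *: ev j + y)) (pd j G y).
  move=> dG; rewrite -[in pd j G y](add0r y) -(scale0r (ev j)).
  by apply: is_derive_line; rewrite scale0r add0r.
have ds1 : is_derive (F (0 *: ev j + y)) 1 sigma (derive1 sigma (F y)).
  by rewrite scale0r add0r derive1E; exact: derivableP ds.
have [dc Ec] := @is_derive1_comp _ sigma (fun h : R => F (h *: ev j + y)) 0 _ _ ds1 (line0 _ dF).
have dc' : derivable (sigma \o F) y (ev j) := (derivable1P _ _ _).2 dc.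
apply: (DeriveDef dc'); have [_ Ec'] := line0 _ dc'.
exact: etrans (esym Ec') Ec.
Qed.

End PartialDerivatives.

(** * Iterated partial derivatives on an open set and the Leibniz rule *)

Section SmoothClass.
Context {R : realType} {s : nat}.
Variable E : set 'rV[R]_s.
Hypothesis Eo : open E.
Implicit Types (F G : 'rV[R]_s -> R) (y : 'rV[R]_s) (j : 'I_s) (r : seq 'I_s).

(** Partial derivatives up to order [n + 1] exist on [E], in every order of differentiation. The
    recursion peels off the innermost derivative, as [pdr] does. *)
Fixpoint pdiff (n : nat) F : Prop :=
  (forall y j, E y -> derivable F y (ev j)) /\
  (if n is m.+1 then forall j, pdiff m (pd j F) else True).

Lemma pdiff1 n F : pdiff n F -> forall y j, E y -> derivable F y (ev j).
Proof. by case: n => [|n] []. Qed.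

Lemma pdiffS n F : pdiff n.+1 F -> pdiff n F.
Proof.
elim: n F => [|n IH] F [dF pF]; first by split.
by split=> // j; apply: IH; apply: pF.
Qed.

Lemma eq_pd F G j y : (forall x, E x -> F x = G x) -> E y -> pd j F y = pd j G y.
Proof.
move=> FG Ey; apply: near_eq_derive.
by near=> x; apply: FG; near: x; exact: open_nbhs_nbhs.
Unshelve. all: by end_near. Qed.

Lemma eq_derivable F G j y : (forall x, E x -> F x = G x) -> E y ->
  derivable F y (ev j) -> derivable G y (ev j).
Proof.
move=> FG Ey; apply: near_eq_derivable.
by near=> x; apply: FG; near: x; exact: open_nbhs_nbhs.
Unshelve. all: by end_near. Qed.

Lemma eq_pdiff n F G : (forall x, E x -> F x = G x) -> pdiff n F -> pdiff n G.
Proof.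
elim: n F G => [|n IH] F G FG [dF pF]; have dG y j : E y -> derivable G y (ev j) by
  move=> Ey; exact: eq_derivable FG Ey (dF _ _ Ey).
- exact: conj dG I.
- by apply: (conj dG) => j; apply: IH (pF j) => x Ex; apply: eq_pd.
Qed.

Lemma eq_pdr r F G y : (forall x, E x -> F x = G x) -> E y -> pdr r F y = pdr r G y.
Proof.
by elim: r F G => [|j r IH] F G FG Ey /=; [exact: FG|apply: IH => // x Ex; apply: eq_pd].
Qed.

Lemma pdiffD n F G : pdiff n F -> pdiff n G -> pdiff n (fun x => F x + G x).
Proof.
elim: n F G => [|n IH] F G [dF pF] [dG pG];
  have dFG y j (Ey : E y) := derivableD (dF y j Ey) (dG y j Ey).
- exact: conj dFG I.
- apply: (conj dFG) => j; apply: eq_pdiff (IH _ _ (pF j) (pG j)) => x Ex.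
  by rewrite pdD//; [apply: dF|apply: dG].
Qed.

Lemma pdiffM n F G : pdiff n F -> pdiff n G -> pdiff n (fun x => F x * G x).
Proof.
elim: n F G => [|n IH] F G pF pG; have dF := pdiff1 _ _ pF; have dG := pdiff1 _ _ pG.
  exact: conj (fun y j Ey => derivableM (dF y j Ey) (dG y j Ey)) I.
split=> [y j Ey|j]; first exact: derivableM (dF y j Ey) (dG y j Ey).
apply: (@eq_pdiff _ (fun x => pd j F x * G x + F x * pd j G x)) => [x Ex|].
  by rewrite pdM//; [apply: dF|apply: dG].
by apply: pdiffD; apply: IH; [apply: (pF.2 j)|exact: (pdiffS _ _ _)|exact: (pdiffS _ _ _)|apply: (pG.2 j)].
Qed.

Lemma pdiff_cst n (c : R) : pdiff n (fun=> c).
Proof.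
elim: n c => [|n IH] c; split=> //; try by move=> y j _; exact: derivable_cst.
by move=> j; apply: eq_pdiff (IH 0) => x _; rewrite /pd derive_cst.
Qed.

Lemma pdiffZ n (c : R) F : pdiff n F -> pdiff n (fun x => c * F x).
Proof. by move=> pF; apply: pdiffM => //; exact: pdiff_cst. Qed.

Lemma pdiffB n F G : pdiff n F -> pdiff n G -> pdiff n (fun x => F x - G x).
Proof.
move=> pF pG; apply: (@eq_pdiff _ (fun x => F x + -1 * G x)) => [x _|].
  by rewrite mulN1r.
by apply: pdiffD => //; apply: pdiffZ.
Qed.

Lemma pdiff_sum n (J : Type) (l : seq J) (P : pred J) (F : J -> 'rV[R]_s -> R) :
  (forall i, P i -> pdiff n (F i)) -> pdiff n (fun x => \sum_(i <- l | P i) F i x).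
Proof.
move=> pF; elim: l => [|i l IH].
  by apply: eq_pdiff (pdiff_cst n 0) => x _; rewrite big_nil.
case Pi: (P i); last by apply: eq_pdiff IH => x _; rewrite big_cons Pi.
by apply: eq_pdiff (pdiffD _ _ _ (pF _ Pi) IH) => x _; rewrite big_cons Pi.
Qed.

(** All derivatives of [sigma] are treated at once: differentiating the composition with the [k]-th
    one produces the composition with the next, of which one order less is required. *)
Lemma pdiff_comp n (sigma : R -> R) F :
  (forall k x, derivable (derive1n k sigma) x 1) -> pdiff n F ->
  forall k, pdiff n (fun y => derive1n k sigma (F y)).
Proof.
move=> ds pF; elim: n pF => [|n IH] pF k; have dF := pdiff1 _ _ pF.
  apply: conj I => y j Ey.
  by have [] := is_derive_comp_line _ _ _ _ (ds k (F y)) (dF y j Ey).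
split=> [y j Ey|j]; first by have [] := is_derive_comp_line _ _ _ _ (ds k (F y)) (dF y j Ey).
apply: (@eq_pdiff _ (fun y => derive1n k.+1 sigma (F y) * pd j F y)) => [x Ex|].
  by have [_ <-] := is_derive_comp_line _ _ _ _ (ds k (F x)) (dF x j Ex).
by apply: pdiffM; [exact: (IH (pdiffS _ _ pF) k.+1)|exact: (pF.2 j)].
Qed.

Lemma pdrD r F G y : pdiff (size r) F -> pdiff (size r) G -> E y ->
  pdr r (fun x => F x + G x) y = pdr r F y + pdr r G y.
Proof.
elim: r F G => [|j r IH] F G pF pG Ey //=.
rewrite -IH//; [|exact: (pF.2 j)|exact: (pG.2 j)].
by apply: eq_pdr => // x Ex; rewrite pdD//; [exact: (pdiff1 _ _ pF)|exact: (pdiff1 _ _ pG)].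
Qed.

Lemma pdr_cst (c : R) j r y : E y -> pdr (j :: r) (fun=> c) y = 0.
Proof.
have E0 : pd j (fun=> c) = fun=> 0 by apply/funext => x; rewrite /pd derive_cst.
rewrite /= E0 => Ey; elim: r {E0} => [//|i r IH] /=.
by rewrite (_ : pd i _ = fun=> 0)//; apply/funext => x; rewrite /pd derive_cst.
Qed.

Lemma pdrZ r (c : R) F y : pdiff (size r) F -> E y ->
  pdr r (fun x => c * F x) y = c * pdr r F y.
Proof.
elim: r F => [|j r IH] F pF Ey //=; rewrite -IH//; last exact: (pF.2 j).
apply: eq_pdr => // x Ex; rewrite pdM; [|exact: derivable_cst|exact: (pdiff1 _ _ pF)].
by rewrite /pd derive_cst mul0r add0r.
Qed.

Lemma pdrB r F G y : pdiff (size r) F -> pdiff (size r) G -> E y ->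
  pdr r (fun x => F x - G x) y = pdr r F y - pdr r G y.
Proof.
move=> pF pG Ey.
rewrite -mulN1r -pdrZ// -pdrD//; last exact: pdiffZ.
by apply: eq_pdr => // x _; rewrite mulN1r.
Qed.

Lemma pdr_sum r (J : Type) (l : seq J) (F : J -> 'rV[R]_s -> R) y :
  (forall i, pdiff (size r) (F i)) -> E y ->
  pdr r (fun x => \sum_(i <- l) F i x) y = \sum_(i <- l) pdr r (F i) y.
Proof.
move=> pF Ey; elim: l => [|i l IH].
  rewrite big_nil (_ : (fun x => _) = fun=> 0); last by apply/funext => x; rewrite big_nil.
  by case: r pF => [//|j r _]; exact: pdr_cst.
rewrite big_cons -IH -pdrD//; last exact: pdiff_sum.
by apply: eq_pdr => // x _; rewrite big_cons.
Qed.

(** The Leibniz rule and the shuffle product have the same recursion. The factors are controlled on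
    subsequences of [r] only, which later confines the argument to derivatives taken in the fixed
    order of the coordinates. *)
Lemma pdrM_le r F G (f g : shuf R 'I_s) y : pdiff (size r) F -> pdiff (size r) G -> E y ->
  (forall r', subseq r' r -> `|pdr r' F y| <= f r') ->
  (forall r', subseq r' r -> `|pdr r' G y| <= g r') ->
  `|pdr r (fun x => F x * G x) y| <= (f * g) r.
Proof.
elim: r F G f g => [|j r IH] F G f g pF pG Ey Ff Gg.
  by rewrite shE_nil normrM ler_pM//; [apply: (Ff [::])|apply: (Gg [::])].
have -> : pdr (j :: r) (fun x => F x * G x) y =
    pdr r (fun x => pd j F x * G x) y + pdr r (fun x => F x * pd j G x) y.
  rewrite -[LHS]/(pdr r (pd j (fun x => F x * G x)) y).
  rewrite -pdrD//; [|by apply: pdiffM; [exact: (pF.2 j)|exact: (pdiffS _ _ _)]|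
                     by apply: pdiffM; [exact: (pdiffS _ _ _)|exact: (pG.2 j)]].
  by apply: eq_pdr => // x Ex; rewrite pdM//; [exact: (pdiff1 _ _ pF)|exact: (pdiff1 _ _ pG)].
have lift (H : 'rV[R]_s -> R) h : (forall r', subseq r' (j :: r) -> `|pdr r' H y| <= h r') ->
    (forall r', subseq r' r -> `|pdr r' H y| <= h r') /\
    (forall r', subseq r' r -> `|pdr r' (pd j H) y| <= (shD j h) r').
  move=> Hh; split=> r' r'r; first by apply: Hh; apply: subseq_trans r'r (subseq_cons _ _).
  by apply: (Hh (j :: r')); rewrite /= eqxx.
have [Ff1 Ff2] := lift _ _ Ff; have [Gg1 Gg2] := lift _ _ Gg.
rewrite shE_cons; apply: le_trans (ler_normD _ _) _; apply: lerD; apply: IH => //.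
all: by [exact: (pF.2 j)|exact: (pG.2 j)|exact: (pdiffS _ _ _)].
Qed.

End SmoothClass.

(** * Functions of a single coordinate *)

Section Coordinates.
Context {R : realType} {s : nat}.
Implicit Types (phi : R -> R) (i j : 'I_s) (y : 'rV[R]_s).

Lemma derivable_coord y i v : derivable (fun x : 'rV[R]_s => x 0 i) y v.
Proof. exact/diff_derivable/differentiable_coord. Qed.

Lemma pd_coord i j y : pd j (fun x : 'rV[R]_s => x 0 i) y = (j == i)%:R.
Proof.
have d := (derivable_coord y i (ev j)).
have := @is_derive_line _ _ (fun x : 'rV[R]_s => x 0 i) y j 0.
rewrite scale0r add0r => /(_ d) [_ <-].
rewrite (_ : (fun h : R => _) = (fun h : R => h * (j == i)%:R + y 0 i)); last first.
  by apply/funext => h; rewrite !mxE eqxx/= eq_sym.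
rewrite (_ : (fun h : R => _) = (id : R -> R) * cst (j == i)%:R + cst (y 0 i))//.
have did : derivable (id : R -> R) 0 1  by exact: derivable_id.
have dcst c : derivable (cst c : R -> R) (0 : R) 1  by exact: derivable_cst.
apply: (etrans (deriveD (derivableM did (dcst _)) (dcst _))).
rewrite derive_cst addr0; apply: (etrans (deriveM did (dcst _))).
by rewrite derive_cst derive_id scaler0 add0r [LHS]mulr1.
Qed.

Lemma pd_comp_coord phi i j : (forall x, derivable phi x 1) ->
  pd j (fun y => phi (y 0 i)) = fun y => if j == i then derive1 phi (y 0 i) else 0.
Proof.
move=> dphi; apply/funext => y.
have [_ E] := is_derive_comp_line phi (fun x : 'rV[R]_s => x 0 i) j y (dphi _) (derivable_coord _ _ _).
rewrite -[LHS]/(derive (phi \o (fun x : 'rV[R]_s => x 0 i)) y (ev j)) E pd_coord.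
by case: ifP; rewrite ?mulr1 ?mulr0.
Qed.

Lemma pdr_comp_coord phi i r : (forall n x, derivable (derive1n n phi) x 1) ->
  pdr r (fun y => phi (y 0 i)) =
  fun y => if all (pred1 i) r then derive1n (size r) phi (y 0 i) else 0.
Proof.
elim: r phi => [//|j r IH] phi dphi.
rewrite /= pd_comp_coord; last by move=> x; exact: (dphi 0%N).
case: eqP => _ /=.
  rewrite -/(pdr r _) IH; last by move=> n x; rewrite -derive1Sn; exact: dphi.
  by apply/funext => y; rewrite -derive1Sn.
apply/funext => y.
by case: r {IH} => [//|k r]; rewrite -[LHS]/(pdr (k :: r) (fun=> 0) y) (pdr_cst setT).
Qed.

Lemma pdiff_comp_coord n phi i : (forall n x, derivable (derive1n n phi) x 1) ->
  pdiff setT n (fun y => phi (y 0 i)).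
Proof.
move=> dphi; apply: (pdiff_comp setT openT n phi _ dphi _ 0).
elim: n => [|n IH]; split=> //; try by move=> y j _; exact: derivable_coord.
move=> j; apply: (@eq_pdiff _ _ setT openT _ (fun=> (j == i)%:R)).
  by move=> y _; rewrite pd_coord.
exact: pdiff_cst openT _ _.
Qed.

End Coordinates.

(** * Composition with the activation function *)

Section Layer.
Context {R : realType} {s : nat}.
Implicit Types (j : 'I_s) (y : 'rV[R]_s).

(** With [Gamma = a z / (1 - c z)] the majorant of [g], the k-th derivative of
    [sigma] along [g] is majorized by [xi tau^k k! B^(k+1)], where
    [B = 1 / (1 - tau Gamma) = (1 - c z) / (1 - (c + tau a) z)]. *)
Lemma comp_majorant (sigma : R -> R) (xi tau a c : R) (z : shuf R 'I_s)
    (g : 'rV[R]_s -> R) :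
  (forall n x, derivable (derive1n n sigma) x 1) ->
  (forall n x, (1 <= n)%N -> `|derive1n n sigma x| <= xi * tau ^+ n * n`!%:R) ->
  z [::] = 0 -> (forall n, pdiff setT n g) ->
  (forall j r y, `|pdr (j :: r) g y| <=
     (cst_shuf a * geo (cst_shuf c * z) ^+ 2 * shD j z) r) ->
  forall j r y, `|pdr (j :: r) (fun x => sigma (g x)) y| <=
     (cst_shuf (xi * tau * a) * geo (cst_shuf (c + tau * a) * z) ^+ 2 * shD j z) r.
Proof.
move=> ds bs z0 pg bg.
set q := geo (cst_shuf c * z); set c' := c + tau * a; set q' := geo (cst_shuf c' * z).
have cz0 e : (cst_shuf e * z) [::] = 0 by rewrite cst_shufM z0 mulr0.
have qK : (1 - cst_shuf c * z) * q = 1 := geoM _ (cz0 c).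
have qK' : (1 - cst_shuf c' * z) * q' = 1 := geoM _ (cz0 c').
pose B := (1 - cst_shuf c * z) * q'.
have BK : B * q = q' by rewrite /B mulrAC qK mul1r.
(* Since [cst_shuf a * q ^+ 2 * shD j z] is the derivative of [Gamma], this reads
   [B' = tau Gamma' B^2]. Hence differentiating [xi tau^k k! B^(k+1)] gives [Gamma'] times the next
   member of the family, as for the derivatives of [sigma] along [g]. *)
have DB j : shD j B = cst_shuf tau * (cst_shuf a * q ^+ 2 * shD j z) * B ^+ 2.
  rewrite [RHS](_ : _ = cst_shuf tau * cst_shuf a * shD j z * (B * q) ^+ 2); last by ring.
  rewrite BK /B shDM shDD shDN shD1 shDcM shD_geo// shDcM add0r -/q'.
  rewrite (_ : - _ * q' = - (cst_shuf c * shD j z) * (q' * ((1 - cst_shuf c' * z) * q'))); last first.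
    by rewrite qK' mulr1.
  by rewrite /c' rmorphD rmorphM /=; ring.
have B1 : B [::] = 1 by rewrite /B shE_nil /q' geo_nil shaddE shoppE cz0 subr0 mulr1.
have sg k n : pdiff setT n (fun x => derive1n k sigma (g x)).
  exact: pdiff_comp openT _ _ _ ds (pg n) k.
have step k j r y : pdr (j :: r) (fun x => derive1n k sigma (g x)) y =
    pdr r (fun x => derive1n k.+1 sigma (g x) * pd j g x) y.
  congr (pdr r _ y); apply/funext => x.
  by have [_ <-] := is_derive_comp_line _ _ j x (ds k (g x)) (pdiff1 _ _ _ (pg 0%N) x j I).
have dg j n : pdiff setT n (pd j g) by exact: ((pg n.+1).2 j).
(* Only derivatives of [sigma] of order at least one are bounded, hence the index [k.+1] here and
   the nonempty lists in the statement. At the empty list the claim is the bound on [sigma], because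
   [B] has constant term [1]. *)
have main n : forall r k y, (size r <= n)%N ->
    `|pdr r (fun x => derive1n k.+1 sigma (g x)) y| <=
    (cst_shuf (xi * tau ^+ k.+1 * (k.+1)`!%:R) * B ^+ k.+2) r.
  elim: n => [|n IH] [|j r] k y // rn.
  - by rewrite cst_shufM shX_nil B1 expr1n mulr1; exact: bs.
  - by rewrite cst_shufM shX_nil B1 expr1n mulr1; exact: bs.
  rewrite step.
  apply: le_trans (pdrM_le setT openT r _ _
    (cst_shuf (xi * tau ^+ k.+2 * (k.+2)`!%:R) * B ^+ k.+3)
    (cst_shuf a * q ^+ 2 * shD j z) y _ _ _ _ _) _ => //.
  - by move=> r' /size_subseq r'r; apply: IH; exact: leq_trans r'r rn.
  - by move=> r' _; exact: (bg j r' y).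
  rewrite [X in X r <= _](_ : _ = shD j (cst_shuf (xi * tau ^+ k.+1 * (k.+1)`!%:R) * B ^+ k.+2))//.
  rewrite shDcM shDX DB (factS k.+1) !exprS !natrM !rmorphM /= !rmorph_nat.
  ring.
move=> j r y; rewrite (step 0%N).
apply: le_trans (pdrM_le setT openT r _ _
    (cst_shuf (xi * tau ^+ 1 * 1`!%:R) * B ^+ 2)
    (cst_shuf a * q ^+ 2 * shD j z) y _ _ _ _ _) _ => //.
- by move=> r' _; apply: (main (size r')).
- by move=> r' _; exact: (bg j r' y).
rewrite [X in X r <= _](_ : _ = cst_shuf (xi * tau * a) * q' ^+ 2 * shD j z)//.
rewrite -BK expr1 (_ : 1`! = 1%N)// mulr1 !rmorphM /=; ring.
Qed.

End Layer.

(** * Majorants of networks *)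

Section Activations.
Context {R : realType}.

Lemma derive1n_phi_id n : derive1n n (phi_id : R -> R) =
  if n is m.+1 then (fun=> if m is 0 then 1 else 0) else id.
Proof.
elim: n => [//|n IH]; rewrite derive1nS IH; apply/funext => x.
case: n {IH} => [|n]; rewrite derive1E; first by rewrite derive_id.
by rewrite derive_cst.
Qed.

Lemma derivable_phi_id n (x : R) : derivable (derive1n n phi_id) x 1.
Proof.
rewrite derive1n_phi_id; case: n => [|n]; first exact: derivable_id.
exact: derivable_cst.
Qed.

Lemma phi_id_bound n (x : R) : (1 <= n)%N -> `|derive1n n phi_id x| <= kap_id n.
Proof.
rewrite derive1n_phi_id /kap_id; case: n => [//|[|n]] _ /=; first by rewrite normr1.
by rewrite normr0.
Qed.

Lemma is_derive_sin_affine (a c x : R) :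
  is_derive x 1 (fun t => sin (a * t + c)) (a * cos (a * x + c)).
Proof.
have h : is_derive x 1 ((fun t => a * t + c) : R -> R) a.
  have -> : (fun t => a * t + c) = a \*: (id : R -> R) + cst c by [].
  have := @is_deriveD _ _ _ _ _ x 1 _ _ (@is_deriveZ _ _ _ _ a x 1 _ (is_derive_id x 1))
    (is_derive_cst c x 1).
  by rewrite addr0 [_ *: _]mulr1.
rewrite mulrC; exact: (@is_derive1_comp _ sin (fun t => a * t + c)).
Qed.

Lemma derive1n_phi_sin n : derive1n n (phi_sin : R -> R) =
  fun t => (2 * pi) ^+ n * sin (2 * pi * t + n%:R * (pi / 2)).
Proof.
elim: n => [|n IH].
  by apply/funext => t; rewrite derive1n0 expr0 mul1r mul0r addr0.
rewrite derive1nS IH; apply/funext => t; rewrite derive1E.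
have [d E] := is_derive_sin_affine (2 * pi) (n%:R * (pi / 2)) t.
rewrite -[LHS]/('D_1 (fun t => (2 * pi) ^+ n *: sin (2 * pi * t + n%:R * (pi / 2))) t).
rewrite deriveZ// E (_ : _ + n.+1%:R * (pi / 2) = 2 * pi * t + n%:R * (pi / 2) + pi / 2).
  by rewrite sinDpihalf exprSr [LHS]mulrA.
by rewrite -natr1; ring.
Qed.

Lemma derivable_phi_sin n (x : R) : derivable (derive1n n phi_sin) x 1.
Proof.
rewrite derive1n_phi_sin.
have [d E] := is_derive_sin_affine (2 * pi) (n%:R * (pi / 2)) x.
exact: derivableZ.
Qed.

Lemma phi_sin_bound n (x : R) : (1 <= n)%N -> `|derive1n n phi_sin x| <= kap_sin n.
Proof.
move=> _; rewrite derive1n_phi_sin normrM ger0_norm; last first.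
  by rewrite exprn_ge0// mulr_ge0// pi_ge0.
rewrite ler_piMr ?exprn_ge0 ?mulr_ge0 ?pi_ge0// ler_norml.
by rewrite sin_geN1 sin_le1.
Qed.

Lemma phi_sin_periodic (x : R) : phi_sin (x + 1) = phi_sin x.
Proof. by rewrite /phi_sin mulrDr mulr1 mulr_natl; exact: sinD2pi. Qed.

End Activations.

Section MeanValue.
Context {R : realType}.

Lemma derivable_lipschitz (f : R -> R) (K : R) :
  (forall x, derivable f x 1) -> (forall x, `|derive1 f x| <= K) ->
  forall x y, `|f y - f x| <= K * `|y - x|.
Proof.
move=> df bf.
have H x y : x <= y -> `|f y - f x| <= K * `|y - x|.
  move=> xy; have [||c _ ->] := @MVT_segment R f (derive1 f) x y xy.
  - by move=> z _; rewrite derive1E; exact: derivableP.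
  - apply: continuous_subspaceT => z.
    exact/differentiable_continuous/derivable1_diffP.
  - by rewrite normrM ler_wpM2r.
move=> x y; have [/H//|/ltW/H] := leP x y.
by rewrite distrC (distrC x).
Qed.

End MeanValue.

(** * Majorant of the whole network and its values on the cube *)

Section Network.
Context {R : realType}.
Variables (d : nat -> nat) (W : forall l, 'M[R]_(d l.+1, d l))
  (v : forall l, 'I_(d l.+1) -> R) (sigma phi : R -> R).
Variables (xi tau C : R) (Rl kappa : nat -> R) (b : nat -> R) (L : nat).
Hypothesis L1 : (1 <= L)%N.
Hypothesis dsigma : forall (n : nat) (x : R), derivable (derive1n n sigma) x 1.
Hypothesis xi0 : 0 < xi.
Hypothesis tau0 : 0 < tau.
Hypothesis bsigma : forall (n : nat) (x : R), (1 <= n)%N ->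
  `|derive1n n sigma x| <= xi * tau ^+ n * n`!%:R.
Hypothesis WR : forall l : nat, (1 <= l <= L)%N -> 0 < Rl l /\ mxinf (W l) <= Rl l.
Hypothesis b0 : forall j : nat, (1 <= j)%N -> 0 < b j.
Hypothesis W0b : forall (p : 'I_(d 1%N)) (j : 'I_(d 0%N)),
  `|W 0%N p j| <= b (nat_of_ord j).+1 / SL xi tau Rl L.
Hypothesis dphi : forall (n : nat) (x : R), derivable (derive1n n phi) x 1.
Hypothesis bphi : forall (n : nat) (x : R), (1 <= n)%N -> `|derive1n n phi x| <= kappa n.
Hypothesis kappa0 : forall n, 0 <= kappa n.
Local Notation s := (d 0%N).
Let S := SL xi tau Rl L.
(** The admissible bound on column [j] of the first matrix rather than its actual maximum, so that
    [S z] is exactly the majorant with coefficients [b_j]. *)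
Let beta (j : 'I_s) : R := b (nat_of_ord j).+1 / S.
Let z : shuf R 'I_s := lin_maj beta kappa.
Let net_ l p := fun y : 'rV[R]_s => net W v sigma phi l y p.

Lemma PkS k : Pk xi tau Rl k.+1 = Pk xi tau Rl k * (xi * tau * Rl k.+1).
Proof. by rewrite /Pk big_nat_recr. Qed.

Lemma SLS k : SL xi tau Rl k.+1 = SL xi tau Rl k + tau * Pk xi tau Rl k.
Proof. by rewrite /SL big_nat_recr//= mulrDr. Qed.

Lemma Pk_gt0 k : (k <= L)%N -> 0 < Pk xi tau Rl k.
Proof.
elim: k => [|k IH] kL; first by rewrite /Pk big_geq.
rewrite PkS mulr_gt0//; first exact/IH/ltnW.
by rewrite !mulr_gt0//; have [] := WR k.+1 kL.
Qed.

Lemma SL_gt0 k : (1 <= k <= L)%N -> 0 < SL xi tau Rl k.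
Proof.
elim: k => [//|k IH] /= kL; rewrite SLS.
have P0 : 0 < tau * Pk xi tau Rl k by rewrite mulr_gt0// Pk_gt0// ltnW.
case: k => [|k] in IH kL P0 *; last by rewrite addr_gt0// IH//= ltnW.
by rewrite /SL big_geq// mulr0 add0r.
Qed.

Let S0 : 0 < S. Proof. by apply: SL_gt0; rewrite L1 leqnn. Qed.
Let beta_ge0 j : 0 <= beta j. Proof. by rewrite divr_ge0 ?ltW// b0. Qed.
Let z_ge0 : shle 0 z. Proof. exact: lin_maj_ge0. Qed.
Let z_nil : z [::] = 0. Proof. exact: lin_maj_nil. Qed.

Lemma net_pdiff l p n : pdiff setT n (net_ l p).
Proof.
elim: l p n => [|l IH] p n; apply: (pdiffD _ openT); try exact: (pdiff_cst _ openT).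
  by apply: (pdiff_sum _ openT) => j _; apply: (pdiffZ _ openT); exact: pdiff_comp_coord.
apply: (pdiff_sum _ openT) => j _; apply: (pdiffZ _ openT).
exact: (pdiff_comp _ openT _ _ _ dsigma (IH j n) 0).
Qed.

(** The right side is the derivative of [P_l z / (1 - S_l z)]. Composition with [sigma] turns [P_l]
    into [xi tau P_l] and [S_l] into [S_l + tau P_l], which is the next [S]; the row sums of the
    next matrix supply the factor [R] that completes the next [P]. *)
Lemma net_majorant l p : (l <= L)%N -> forall j r y,
  `|pdr (j :: r) (net_ l p) y| <=
  (cst_shuf (Pk xi tau Rl l) * geo (cst_shuf (SL xi tau Rl l) * z) ^+ 2 * shD j z) r.
Proof.
elim: l p => [|l IH] p lL j r y.
  rewrite (_ : SL xi tau Rl 0 = 0); last by rewrite /SL big_geq// mulr0.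
  rewrite (_ : Pk xi tau Rl 0 = 1); last by rewrite /Pk big_geq.
  have -> : geo (cst_shuf 0 * z) = 1.
    by rewrite rmorph0 mul0r -[RHS](@geoM _ _ 0)// subr0 mul1r.
  rewrite rmorph1 expr1n !mul1r.
  have pW i : pdiff setT (size (j :: r)) (fun x : 'rV_s => W 0%N p i * phi (x 0 i)).
    by apply: (pdiffZ _ openT); exact: pdiff_comp_coord.
  rewrite (pdrD _ openT)//; [|by apply: (pdiff_sum _ openT)|exact: (pdiff_cst _ openT)].
  rewrite (pdr_cst setT)// addr0 (pdr_sum _ openT)//.
  rewrite [leRHS](_ : _ = \sum_i beta i * coord_maj kappa i (j :: r)); last first.
    by rewrite /shD /z /lin_maj shsumE; apply: eq_bigr => i _; rewrite cst_shufM.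
  apply: le_trans (ler_norm_sum _ _ _) _; apply: ler_sum => i _.
  rewrite (pdrZ _ openT)//; last exact: pdiff_comp_coord.
  rewrite normrM ler_pM// pdr_comp_coord// /coord_maj.
  by case: ifP; rewrite ?normr0// => _; exact: bphi.
have c0 : 0 <= SL xi tau Rl l.
  case: (posnP l) => [->|l0]; first by rewrite /SL big_geq// mulr0.
  by rewrite ltW// SL_gt0// l0 ltnW.
set M := cst_shuf (xi * tau * Pk xi tau Rl l) *
   geo (cst_shuf (SL xi tau Rl l + tau * Pk xi tau Rl l) * z) ^+ 2 * shD j z.
have P0 : 0 < Pk xi tau Rl l by rewrite Pk_gt0// ltnW.
have M0 : shle 0 M.
  apply: shmul_ge0; last by move=> r'; exact: (z_ge0 (j :: r')).
  apply: shmul_ge0; first by apply: cst_shuf_ge0; rewrite !mulr_ge0// ltW.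
  apply: shX_ge0; apply: geo_ge0; apply: shmul_ge0 => //; apply: cst_shuf_ge0.
  by rewrite addr_ge0// mulr_ge0// ltW.
have gM q : `|pdr (j :: r) (fun x => sigma (net_ l q x)) y| <= M r.
  apply: (comp_majorant _ _ _ _ _ _ _ dsigma bsigma z_nil) => [n|j' r' y'].
    exact: net_pdiff.
  by apply: IH; exact: ltnW.
have pW q : pdiff setT (size (j :: r)) (fun x : 'rV_s => W l.+1 p q * sigma (net_ l q x)).
  apply: (pdiffZ _ openT).
  exact: (pdiff_comp _ openT _ _ _ dsigma (net_pdiff l q _) 0).
rewrite (pdrD _ openT)//; [|by apply: (pdiff_sum _ openT)|exact: (pdiff_cst _ openT)].
rewrite (pdr_cst setT)// addr0 (pdr_sum _ openT)//.
have [R0 WRl] := WR l.+1 lL.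
rewrite [leRHS](_ : _ = Rl l.+1 * M r); last first.
  rewrite -cst_shufM PkS SLS [X in X r = _](_ : _ = cst_shuf (Rl l.+1) * M)//.
  by rewrite /M !rmorphM /=; ring.
apply: le_trans (ler_norm_sum _ _ _) _.
apply: (@le_trans _ _ (\sum_q `|W l.+1 p q| * M r)).
  apply: ler_sum => q _; rewrite (pdrZ _ openT); first by rewrite normrM ler_wpM2l// gM.
    exact: (pdiff_comp _ openT _ _ _ dsigma (net_pdiff l q _) 0).
  by [].
rewrite -mulr_suml ler_wpM2r//; first exact: M0.
apply: le_trans WRl; rewrite /mxinf.
exact: (le_bigmax _ (fun p => \sum_q `|W l.+1 p q|) p).
Qed.

Lemma netS l y p : net W v sigma phi l.+1 y p =
  \sum_(q < d l.+1) W l.+1 p q * sigma (net W v sigma phi l y q) + v l.+1 p.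
Proof. by []. Qed.

(** The supremum in [netsup] bounds the outputs only once they are known to be bounded on the cube.
    A bounded first derivative gives [sigma] at most linear growth, so boundedness passes from layer
    to layer. *)
Lemma net_bounded_cube (l : nat) (p : 'I_(d l.+1)) :
  (forall x, `|phi x| <= `|phi 0| + `|x| * kappa 1) ->
  exists M, forall y : 'rV[R]_s, cube y -> `|net W v sigma phi l y p| <= M.
Proof.
move=> phib; elim: l p => [|l IH] p.
  exists (\sum_j `|W 0%N p j| * (`|phi 0| + kappa 1) + `|v 0%N p|) => y cy.
  apply: le_trans (ler_normD _ _) _; rewrite lerD2r.
  apply: le_trans (ler_norm_sum _ _ _) _; apply: ler_sum => j _.
  rewrite normrM ler_wpM2l//; apply: le_trans (phib _) _; rewrite lerD2l ler_piMl//.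
  by have /andP[y0 y1] := cy j; rewrite ger0_norm.
have /choice[M HM] := IH.
exists (\sum_q `|W l.+1 p q| * (`|sigma 0| + xi * tau * `|M q|) + `|v l.+1 p|) => y cy.
rewrite netS; apply: le_trans (ler_normD _ _) _; rewrite lerD2r.
apply: le_trans (ler_norm_sum _ _ _) _; apply: ler_sum => q _.
rewrite normrM ler_wpM2l//.
set x := net _ _ _ _ _ _ _.
have xM : `|x| <= `|M q| by apply: le_trans (HM q y cy) (ler_norm _).
have Hs : `|sigma x - sigma 0| <= xi * tau * `|x - 0|.
  apply: derivable_lipschitz => [t|t]; first exact: (dsigma 0).
  by have := bsigma 1 t isT; rewrite derive1n1 expr1 mulr1.
rewrite -[sigma x](subrK (sigma 0)) addrC; apply: le_trans (ler_normD _ _) _.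
rewrite lerD2l; apply: le_trans Hs _; rewrite subr0 ler_wpM2l//.
by rewrite mulr_ge0// ltW.
Qed.

Lemma net_bound_cube p y : CL (net W v sigma phi L) xi tau Rl L <= C -> cube y ->
  `|net W v sigma phi L y p| <= C.
Proof.
move=> CLC cy; apply: le_trans CLC; rewrite /CL le_max; apply/orP; left.
have phib x : `|phi x| <= `|phi 0| + `|x| * kappa 1.
  rewrite -[phi x](subrK (phi 0)) addrC; apply: le_trans (ler_normD _ _) _.
  rewrite lerD2l mulrC -{2}(subr0 x).
  apply: derivable_lipschitz => [t|t]; first exact: (dphi 0).
  by have := bphi 1 t isT; rewrite derive1n1.
apply: sup_upper_bound; last by exists y, p.
split; first by exists `|net W v sigma phi L y p|, y, p.
have /choice[M HM] := net_bounded_cube L ^~ phib.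
exists (\sum_q `|M q|) => _ [y' [q [cy' ->]]].
apply: le_trans (HM q y' cy') _; apply: le_trans (ler_norm _) _.
by rewrite (bigD1 q)//= lerDl sumr_ge0.
Qed.

(** The two parts of [CL] serve the two cases. Values are bounded by [netsup]; for derivatives,
    [P_L z / (1 - S z)] and [C / (1 - S z)] have derivatives that differ only in the factors [P_L]
    and [C S], and [P_L <= C S]. *)
Lemma net_dominated p r y : CL (net W v sigma phi L) xi tau Rl L <= C -> cube y ->
  `|pdr r (net_ L p) y| <= C * geo_pow (coordb b) kappa 0 r.
Proof.
move=> CLC cy; have C0 : 0 <= C := le_trans (normr_ge0 _) (net_bound_cube p y CLC cy).
case: r => [|j r]; first by rewrite geo_pow_nil mulr1; exact: net_bound_cube.
apply: le_trans (net_majorant L p (leqnn _) j r y) _.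
have zS : cst_shuf S * z = lin_maj (coordb b) kappa.
  rewrite /z /lin_maj mulr_sumr; apply: eq_bigr => i _.
  by rewrite mulrA -rmorphM /= /beta [S * _]mulrC divfK// gt_eqF.
rewrite zS -[leRHS]cst_shufM /geo_pow rmorph1 mul1r expr1.
rewrite -[leRHS]/(shD j (cst_shuf C * geo (lin_maj (coordb b) kappa)) r) shDcM.
have DzS : shD j (lin_maj (coordb b) kappa) = cst_shuf S * shD j z by rewrite -zS shDcM.
rewrite shD_geo ?lin_maj_nil// DzS.
rewrite [X in _ <= X r](_ : _ = cst_shuf C * cst_shuf S * (geo (lin_maj (coordb b) kappa) ^+ 2 * shD j z)); last by ring.
rewrite -rmorphM -mulrA !cst_shufM ler_wpM2r//.
  apply: shmul_ge0; last by move=> r'; exact: (z_ge0 (j :: r')).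
  apply: shX_ge0; apply: geo_ge0; apply: lin_maj_ge0 => // i; rewrite ltW// b0//.
move: CLC; rewrite /CL ge_max => /andP[_].
by rewrite ler_pdivrMr.
Qed.

End Network.

(** * Integrals over the unit cube and Sobolev norms *)

Section UnitIntervalIntegral.
Context {R : realType}.
Local Notation mu := (@lebesgue_measure R).
Implicit Types (f : R -> R) (M : R).

(** No measurability of [f] is assumed: the integral of a nonnegative function is
    defined as a supremum over the simple functions below it. *)
Lemma ge0_integral_le_unit f M : (forall t, 0 <= f t) -> 0 <= M ->
  (forall t, 0 < t < 1 -> f t <= M) ->
  (\int[mu]_(t in `[0%R, 1%R]) (f t)%:E <= M%:E)%E.
Proof.
move=> f0 M0 fM.
(* Nothing bounds [f] at the endpoints, so the comparison function keeps its values there; being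
   constant on the open interval, it has integral [M]. *)
pose h (t : R) : R := if (t == 0) || (t == 1) then f t else M.
have h0 t : 0 <= h t by rewrite /h; case: ifP.
have hE t : 0 < t < 1 -> h t = M by rewrite /h => /andP[t0 t1]; rewrite gt_eqF// lt_eqF.
have hI : (\int[mu]_(t in `[0%R, 1%R]) (h t)%:E = M%:E)%E.
  rewrite integral_itv_bndoo; last first.
    apply/measurable_realfun.measurable_EFinP; apply: (eq_measurable_fun (cst M)); last exact: measurable_cst.
    by move=> t; rewrite inE /= in_itv/= => /hE ->.
  under eq_integral => t.
    rewrite inE /= in_itv/= => t01; rewrite (hE _ t01); over.
  by rewrite integral_cst//= lebesgue_measure_itv/= lte01 oppr0 adde0 mule1.
rewrite -hI integral_mkcond [leRHS]integral_mkcond.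
have fh t : (((fun t => (f t)%:E) \_ `[0%R, 1%R]) t <= ((fun t => (h t)%:E) \_ `[0%R, 1%R]) t)%E.
  rewrite /patch; case: ifPn => //; rewrite inE /= in_itv/= lee_fin => /andP[t0 t1].
  rewrite /h; case: ifPn => // /norP[tn0 tn1].
  by apply: fM; rewrite lt_neqAle eq_sym tn0 t0 lt_neqAle tn1.
rewrite !ge0_integralTE; [|by move=> t; apply: erestrict_ge0 => // x; rewrite lee_fin
                          |by move=> t; apply: erestrict_ge0 => // x; rewrite lee_fin].
apply: ereal_sup_le => _ [g /= gf <-]; exists g => // t.
exact: le_trans (gf t) (fh t).
Qed.

(** The positive and the negative part each have an integral between [0] and [M], and the difference
    of two such numbers has absolute value at most [M]. *)
Lemma Rintegral_norm_le f M : (forall t, 0 < t < 1 -> `|f t| <= M) ->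
  `|\int[mu]_(t in `[(0:R), 1]) f t| <= M.
Proof.
move=> fM.
have M0 : 0 <= M by apply: le_trans (fM (2^-1) _) => //; lra.
rewrite /Rintegral integralE.
have fin (x : \bar R) : (0 <= x)%E -> (x <= M%:E)%E -> exists2 r, x = r%:E & 0 <= r <= M.
  by case: x => [r| |] //; rewrite !lee_fin => r0 rM; exists r => //; rewrite r0.
have part (g : R -> R) : (forall t, `|g t| = `|f t|) ->
    exists2 r, (\int[mu]_(t in `[0%R, 1%R]) (Num.max (g t) 0)%:E)%E = r%:E & 0 <= r <= M.
  move=> gf; apply: fin.
    by apply: integral_ge0 => t _; rewrite lee_fin le_max lexx orbT.
  apply: ge0_integral_le_unit => // t; first by rewrite le_max lexx orbT.
  by move=> t01; rewrite ge_max M0 andbT (le_trans (ler_norm _))// gf fM.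
have [p Ep /andP[p0 pM]] := part f (fun=> erefl).
have [n En /andP[n0 nM]] := part (fun t => - f t) (fun t => normrN _).
rewrite (_ : (fun t => (f t)%:E)^\+%E = fun t => (Num.max (f t) 0)%:E); last first.
  by apply/funext => t; rewrite funeposE EFin_max.
rewrite (_ : (fun t => (f t)%:E)^\-%E = fun t => (Num.max (- f t) 0)%:E); last first.
  by apply/funext => t; rewrite funenegE EFin_max.
by rewrite Ep En /= ler_norml; apply/andP; split; lra.
Qed.

Lemma continuous_integrable_segment f (a c : R) : continuous f ->
  mu.-integrable `[a, c] (EFin \o f).
Proof.
move=> cf; apply: continuous_compact_integrable; first exact: segment_compact.
exact: continuous_subspaceT.
Qed.

Lemma Rintegral_periodic_shift f (e : R) : continuous f ->
  (forall t, f (t + 1) = f t) -> 0 <= e ->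
  \int[mu]_(t in `[(0:R), 1]) f (t + e) = \int[mu]_(t in `[(0:R), 1]) f t.
Proof.
move=> cf pf e0.
(* The lower limit [-1] leaves room to the left of [0], so that [F] is differentiable at every point
   in use. *)
pose F x := \int[mu]_(t in `[(-1:R), x]) f t.
have dF (x : R) : -1 < x -> is_derive x 1 F (f x).
  move=> x1; have x1' : x < x + 1 by lra.
  have [] := @continuous_FTC1_closed R f (-1) x (x + 1) x1' _ x1 (cf x).
    exact: continuous_integrable_segment.
  by move=> d E; apply: (DeriveDef d); rewrite -derive1E.
have dFs (c x : R) : -1 < x + c -> is_derive x 1 (fun t => F (t + c)) (f (x + c)).
  move=> xc; have := @is_derive1_comp _ F (fun t => t + c) x (f (x + c)) 1 (dF _ xc).
  by rewrite mulr1; apply; exact: is_derive_shift.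
have cFs (c x : R) : -1 < x + c -> {for x, continuous (fun t => F (t + c))}.
  by move=> xc; apply/differentiable_continuous/derivable1_diffP; case: (dFs c x xc).
have IE (c : R) : 0 <= c -> \int[mu]_(t in `[(0:R), 1]) f (t + c) = F (1 + c) - F c.
  move=> c0; rewrite /Rintegral (@continuous_FTC2 _ _ (fun t => F (t + c)) 0 1 ltr01).
  - by rewrite add0r.
  - apply: continuous_subspaceT => x; apply: continuous_comp; last exact: cf.
    by apply: cvgD; [exact: cvg_id|exact: cvg_cst].
  - split.
    + move=> x; rewrite in_itv/= => /andP[x0 x1].
      by have [] := dFs c x ltac:(lra).
    + by apply: cvg_at_right_filter; apply: cFs; lra.
    + by apply: cvg_at_left_filter; apply: cFs; lra.
  - move=> x; rewrite in_itv/= => /andP[x0 x1]; rewrite derive1E.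
    by have [] := dFs c x ltac:(lra).
have := IE 0 (lexx _); under eq_Rintegral do rewrite addr0.
rewrite addr0 => ->; rewrite IE//.
(* The integral of [f] over [[t, t + 1]]. Periodicity makes its derivative vanish, and the claim is
   [G e = G 0]. *)
pose G t := F (t + 1) - F (t + 0).
have dG (x : R) : -1 < x -> is_derive x 1 G 0.
  move=> x1; have E : f (x + 1) - f (x + 0) = 0 by rewrite pf addr0 subrr.
  have d1 := dFs 1 x ltac:(lra); have d0 := dFs 0 x ltac:(lra).
  exact: is_derive_eq (is_deriveB d1 d0) E.
have [||x _] := @MVT_segment R G (fun=> 0) 0 e e0.
- by move=> x; rewrite in_itv/= => /andP[x0 _]; apply: dG; lra.
- apply: continuous_in_subspaceT => x; rewrite inE/= in_itv/= => /andP[x0 _].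
  by apply/differentiable_continuous/derivable1_diffP; have [] := dG x ltac:(lra).
by rewrite mul0r /G !addr0 add0r (addrC e) => /eqP; rewrite subr_eq0 => /eqP.
Qed.

End UnitIntervalIntegral.

(** * Multi-index derivatives as ordered lists *)

Section MixedDerivatives.
Context {R : realType} {s : nat}.
Implicit Types (F : 'rV[R]_s -> R) (nu : 'I_s -> nat) (u : {set 'I_s}).

Lemma pdr_cat r1 r2 F : pdr (r1 ++ r2) F = pdr r2 (pdr r1 F).
Proof. by rewrite /pdr foldl_cat. Qed.

Lemma pdr_nseq n j F : pdr (nseq n j) F = iter n (pd j) F.
Proof. by elim: n F => [|n IH] F //; rewrite iterSr -IH. Qed.

Lemma dnuE nu F : dnu nu F = pdr (mblocks nu) F.
Proof.
rewrite /dnu /mblocks; elim: (enum 'I_s) => [//|j l IH] /=.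
rewrite rev_cons -cats1 /blocks map_cat flatten_cat /= cats0 pdr_cat pdr_nseq.
by rewrite IH.
Qed.

Lemma dalphaE u a F : dalpha u a F = dnu (ind_idx a u) F.
Proof.
rewrite /dalpha /dnu /ind_idx {1}/enum_mem -enumT.
by elim: (enum 'I_s) => [//|j l IH] /=; case: ifP => _ /=; rewrite IH.
Qed.

(** The sublists produced by the Leibniz rule are again multi-index derivatives in the same order,
    where the bounds on [G] apply. *)
Lemma subseq_mblocks nu r : subseq r (mblocks nu) ->
  exists2 nu', r = mblocks nu' & forall j, (nu' j <= nu j)%N.
Proof.
rewrite /mblocks; move: (rev_uniq (enum 'I_s)); rewrite enum_uniq.
elim: (rev (enum 'I_s)) r => [|j l IH] r /=.
  by move=> _ /eqP ->; exists nu.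
move=> /andP[jl ul]; rewrite [blocks nu _]/(nseq (nu j) j ++ blocks nu l).
move=> /subseqP [m]; rewrite size_cat => sm ->.
rewrite -(cat_take_drop (size (nseq (nu j) j)) m) mask_cat; last first.
  by rewrite size_takel// sm leq_addr.
set r1 := mask (take _ _) _; set r2 := mask (drop _ _) _.
have [nu2 r2E nu2_le] : exists2 nu', r2 = blocks nu' l & forall i, (nu' i <= nu i)%N.
  by apply: IH => //; exact: mask_subseq.
have r1E : r1 = nseq (size r1) j.
  apply/all_pred1P/allP => i /mem_mask; rewrite mem_nseq => /andP[_ /eqP ->].
  exact: eqxx.
exists (fun i => if i == j then size r1 else nu2 i); last first.
  move=> i; case: eqP => // ->; rewrite -[leqRHS](size_nseq _ j).
  by apply: size_subseq; exact: mask_subseq.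
rewrite {1}r1E r2E /blocks /= eqxx; congr (_ ++ flatten _).
by apply/eq_in_map => i il; rewrite (negbTE (memPn jl _ il)).
Qed.

Lemma smooth_pdiff (E : set 'rV[R]_s) F n : smooth_on E F -> pdiff E n F.
Proof.
move=> sF; have : forall js, forall y j, E y -> derivable (pds js F) y (ev j).
  by move=> js y j Ey; exact: (sF js).2.
elim: n F {sF} => [|n IH] F dF; split=> //; try by move=> y j Ey; exact: (dF [::]).
move=> j; apply: IH => js y i Ey.
by have := dF (rcons js j) y i Ey; rewrite /pds -cats1 foldr_cat.
Qed.

End MixedDerivatives.

(** * Sobolev norms from pointwise derivative bounds *)

Section SobolevNorm.
Context {R : realType} {s : nat}.
Implicit Types (F : 'rV[R]_s -> R) (y : 'rV[R]_s) (js : seq 'I_s).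

Lemma updE y j t i : upd y j t 0 i = if i == j then t else y 0 i.
Proof. by rewrite mxE. Qed.

(** The set [S] lists the coordinates that must be interior for the bound on [F]. Those in [js]
    become interior through the integration variable, so a bound on the open cube suffices. *)
Lemma intcs_norm_le (S : {set 'I_s}) js F M :
  (forall y, (forall j, j \in S -> 0 < y 0 j < 1) -> `|F y| <= M) ->
  forall y, (forall j, j \in S -> j \notin js -> 0 < y 0 j < 1) -> `|intcs js F y| <= M.
Proof.
move=> FM; elim: js => [|j js IH] y yS; first by apply: FM => j jS; apply: yS.
apply: Rintegral_norm_le => t t01; apply: IH => i iS ijs.
by rewrite updE; case: eqP => // /eqP ij; apply: yS; rewrite // inE negb_or ij.
Qed.

Lemma wnorm2_le a (gamma : {set 'I_s} -> R) F (D : {set 'I_s} -> R) :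
  (forall u, 0 < gamma u) ->
  (forall u y, ocube y -> `|dalpha u a F y| <= D u) ->
  wnorm2 a gamma F <= \sum_(u : {set 'I_s}) (gamma u)^-1 * D u ^+ 2.
Proof.
move=> g0 FD; have D0 u : 0 <= D u.
  have c : ocube (const_mx 2^-1 : 'rV[R]_s) by move=> j; rewrite mxE; lra.
  exact: le_trans (normr_ge0 _) (FD u _ c).
apply: ler_sum => u _; apply: ler_wpM2l; first by rewrite invr_ge0 ltW.
apply: le_trans (ler_norm _) _.
(* For the outer integral every coordinate of [u] is integrated, so the base point [0] is
   admissible; for the inner one the coordinates of [u] are already interior. *)
apply: (@intcs_norm_le u) => [y yu|y]; last by move=> ju; rewrite mem_enum ju.
rewrite normrX ler_sqr ?nnegrE//.
  apply: (@intcs_norm_le [set: 'I_s]%SET) => [x xs|j _]; first by apply: FD => j; apply: xs; rewrite inE.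
  by rewrite mem_enum finset.inE negbK; exact: yu.

Qed.

End SobolevNorm.

(** * Fourier coefficients and Korobov norms *)

Section SeparatelyLipschitz.
Context {R : realType} {s : nat}.
Implicit Types (F G : 'rV[R]_s -> R) (y : 'rV[R]_s) (i j : 'I_s) (js : seq 'I_s).

(** This property passes to partial integrals and gives continuity along coordinate lines, hence
    integrability at each stage of an iterated integral. *)
Definition seplip (K : R) F :=
  forall j y e, `|F (y + e *: ev j) - F y| <= K * `|e|.

Lemma upd_shift y j (e t : R) : upd (y + e *: ev j) j t = upd y j t.
Proof. by apply/rowP => i; rewrite !mxE; case: eqP => //; rewrite andbF mulr0 addr0. Qed.

Lemma upd_shift_neq y i j (e t : R) : i != j ->
  upd (y + e *: ev i) j t = upd y j t + e *: ev i.
Proof.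
move=> ij; apply/rowP => k; rewrite !mxE eqxx /=; case: eqP => // ->.
by rewrite eq_sym (negbTE ij) mulr0 addr0.
Qed.

Lemma upd_add y j (t e : R) : upd y j (t + e) = upd y j t + e *: ev j.
Proof.
apply/rowP => k; rewrite !mxE eqxx /=.
by case: eqP; rewrite ?mulr1// mulr0 addr0.
Qed.

Lemma seplip_ge0 K F j : seplip K F -> 0 <= K.
Proof. by move=> /(_ j 0 1) /(le_trans (normr_ge0 _)); rewrite normr1 mulr1. Qed.

Lemma seplip_continuous K F y j : seplip K F -> continuous (fun t => F (upd y j t)).
Proof.
move=> FK x; apply/cvgrPdist_le => e e0.
have K0 := seplip_ge0 _ _ j FK.
near=> t.
have -> : upd y j x = upd y j t + (x - t) *: ev j by rewrite -upd_add addrC subrK.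
apply: le_trans (FK _ _ _) _.
apply: (@le_trans _ _ ((K + 1) * `|x - t|)); first by rewrite ler_wpM2r// lerDl.
rewrite -ler_pdivlMl ?ltr_wpDl//.
near: t; apply: cvgr_dist_le; first exact: cvg_id.
by rewrite mulr_gt0// invr_gt0 ltr_wpDl.
Unshelve. all: by end_near. Qed.

Lemma seplip_integrable K F y j : seplip K F ->
  lebesgue_measure.-integrable `[(0:R), 1] (EFin \o (fun t => F (upd y j t))).
Proof. by move=> /seplip_continuous /continuous_integrable_segment. Qed.

Lemma intc_seplip K F j : seplip K F -> seplip K (intc j F).
Proof.
move=> FK i y e; rewrite /intc.
have [->|ij] := eqVneq i j.
  under eq_Rintegral do rewrite upd_shift.
  by rewrite subrr normr0 mulr_ge0// (seplip_ge0 _ _ j FK).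
under eq_Rintegral do rewrite upd_shift_neq//.
rewrite -RintegralB//; last exact: seplip_integrable FK.
  by apply: Rintegral_norm_le => t _; exact: FK.
rewrite (_ : (fun t => F (upd y j t + e *: ev i)) = (fun t => F (upd (y + e *: ev i) j t))).
  exact: seplip_integrable FK.
by apply/funext => t; rewrite upd_shift_neq.
Qed.

Lemma intcs_seplip K F js : seplip K F -> seplip K (intcs js F).
Proof. by move=> FK; elim: js => [//|j js IH] /=; exact: intc_seplip. Qed.

Lemma intcsD K1 K2 F G js y : seplip K1 F -> seplip K2 G ->
  intcs js (fun x => F x + G x) y = intcs js F y + intcs js G y.
Proof.
move=> FK GK; elim: js y => [//|j js IH] y /=.
rewrite /intc; under eq_Rintegral do rewrite IH.
by rewrite RintegralD//; [exact: seplip_integrable (intcs_seplip _ _ js FK)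
                        |exact: seplip_integrable (intcs_seplip _ _ js GK)].
Qed.

Lemma intcs_shift_notin F js j (e : R) y : j \notin js ->
  intcs js F (y + e *: ev j) = intcs js (fun x => F (x + e *: ev j)) y.
Proof.
elim: js y => [//|i js IH] y /=; rewrite inE negb_or => /andP[ji jjs].
by rewrite /intc; apply: eq_Rintegral => t _; rewrite upd_shift_neq// IH.
Qed.

(** At the innermost integral over [x_j] the shift commutes with the integrals further inside, and
    the one-variable shift of a periodic function applies. *)
Lemma intcs_shift K F js j (e : R) y : seplip K F -> periodic1 F -> 0 <= e ->
  j \in js -> intcs js (fun x => F (x + e *: ev j)) y = intcs js F y.
Proof.
move=> FK pF e0; elim: js y => [//|i js IH] y.
have [jjs _|jjs] := boolP (j \in js).
  by rewrite /= /intc; apply: eq_Rintegral => t _; exact: IH.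
rewrite inE (negbTE jjs) orbF => /eqP ji; rewrite -{}ji.
rewrite /= /intc.
under eq_Rintegral do rewrite -intcs_shift_notin// -upd_add.
apply: (@Rintegral_periodic_shift _ (fun t => intcs js F (upd y j t))) => //.
  exact: seplip_continuous (intcs_seplip _ _ js FK).
move=> t; rewrite upd_add intcs_shift_notin//; congr (intcs js _ _).
by apply/funext => x; rewrite scale1r pF.
Qed.

Lemma seplipM K1 K2 M1 M2 F G : seplip K1 F -> seplip K2 G ->
  (forall y, `|F y| <= M1) -> (forall y, `|G y| <= M2) ->
  seplip (K1 * M2 + M1 * K2) (fun y => F y * G y).
Proof.
move=> FK GK FM GM j y e.
rewrite (_ : _ - _ = (F (y + e *: ev j) - F y) * G (y + e *: ev j) +
   F y * (G (y + e *: ev j) - G y)); last by ring.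
apply: le_trans (ler_normD _ _) _; rewrite !normrM mulrDl; apply: lerD.
  by rewrite mulrAC; apply: ler_pM.
by rewrite -mulrA; apply: ler_pM.
Qed.

End SeparatelyLipschitz.

(** * Finite differences in place of derivatives *)

Section FiniteDifferences.
Context {R : realType} {s : nat}.
Variable delta : 'I_s -> R.
Implicit Types (F G : 'rV[R]_s -> R) (y : 'rV[R]_s) (i j : 'I_s) (r : seq 'I_s).

Definition dif j F y := F y - F (y + delta j *: ev j).
Definition difs r F := foldl (fun H j => dif j H) F r.

Lemma dif_comm i j F : dif i (dif j F) = dif j (dif i F).
Proof.
by apply/funext => y; rewrite /dif [y + _ + _]addrAC; ring.
Qed.

Lemma difs_dif r j F : difs r (dif j F) = dif j (difs r F).
Proof. by elim: r F => [//|i r IH] F /=; rewrite dif_comm IH. Qed.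

Lemma derive_shiftE F (c : 'rV[R]_s) j y :
  (derivable (fun x => F (x + c)) y (ev j) <-> derivable F (y + c) (ev j)) /\
  pd j (fun x => F (x + c)) y = pd j F (y + c).
Proof.
rewrite /pd /derivable /derive.
have -> : (fun h : R => h^-1 *: (((fun x => F (x + c)) \o shift y) (h *: ev j) - F (y + c))) =
  (fun h : R => h^-1 *: ((F \o shift (y + c)) (h *: ev j) - F (y + c))).
  by apply/funext => h; rewrite /= addrA.
by [].
Qed.

Lemma pdiff_shift n F c : pdiff setT n F -> pdiff setT n (fun x => F (x + c)).
Proof.
elim: n F => [|n IH] F [dF pF]; have dFc y j : setT y ->
    derivable (fun x => F (x + c)) y (ev j) by
  move=> _; apply/(derive_shiftE _ _ _ _).1; exact: dF.
  exact: conj dFc I.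
apply: (conj dFc) => j; rewrite (_ : pd j _ = fun x => pd j F (x + c)); first exact/IH/pF.
by apply/funext => y; exact: (derive_shiftE _ _ _ _).2.
Qed.

Lemma pdiff_dif n F j : pdiff setT n F -> pdiff setT n (dif j F).
Proof. by move=> pF; apply: (pdiffB _ openT) => //; exact: pdiff_shift. Qed.

Lemma pdiff_difs n r F : pdiff setT n F -> pdiff setT n (difs r F).
Proof. by elim: r F => [//|j r IH] F pF; apply/IH/pdiff_dif. Qed.

Lemma pd_difs r F i : pdiff setT 0 F -> pd i (difs r F) = difs r (pd i F).
Proof.
elim: r F => [//|j r IH] F pF /=; rewrite -/(difs r _) IH; last exact: pdiff_dif.
congr (difs r _); apply/funext => y.
rewrite /dif pdB; [by rewrite (derive_shiftE _ _ _ _).2|exact: pF.1|].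
by apply/(derive_shiftE _ _ _ _).1; exact: pF.1.
Qed.

Lemma seplip_pd F (K : R) : pdiff setT 0 F -> (forall j y, `|pd j F y| <= K) -> seplip K F.
Proof.
move=> pF FK j y e.
have := @derivable_lipschitz R (fun h : R => F (h *: ev j + y)) K _ _ 0 e.
rewrite scale0r add0r subr0 (addrC _ y); apply=> x.
  by have [] := is_derive_line F y j x (pF.1 _ _ I).
by have [_] := is_derive_line F y j x (pF.1 _ _ I); rewrite derive1E => ->.
Qed.

Lemma dif_le F j (K : R) : pdiff setT 0 F -> (forall y, `|pd j F y| <= K) ->
  forall y, `|dif j F y| <= `|delta j| * K.
Proof.
move=> pF FK y; rewrite /dif distrC mulrC.
have := @derivable_lipschitz R (fun h : R => F (h *: ev j + y)) K _ _ 0 (delta j).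
rewrite scale0r add0r subr0 (addrC _ y); apply=> x.
  by have [] := is_derive_line F y j x (pF.1 _ _ I).
by have [_] := is_derive_line F y j x (pF.1 _ _ I); rewrite derive1E => ->.
Qed.

Lemma difs_le r F (B : R) : (forall n, pdiff setT n F) ->
  (forall y, `|pdr r F y| <= B) ->
  forall y, `|difs r F y| <= (\prod_(j <- r) `|delta j|) * B.
Proof.
elim: r F => [|j r IH] F pF FB y; first by rewrite big_nil mul1r; exact: FB.
(* With [dif j] outermost, the mean value theorem trades it for [pd j], which commutes with the
   other differences; induction then applies to [pd j F]. *)
rewrite /= -/(difs r _) difs_dif big_cons -mulrA.
apply: dif_le => [|x]; first exact: pdiff_difs.
by rewrite pd_difs//; apply: IH => [n|//]; exact: ((pF n.+1).2 j).
Qed.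

Lemma dif_periodic F j : periodic1 F -> periodic1 (dif j F).
Proof. by move=> pF i y; rewrite /dif pF addrAC pF. Qed.

Lemma dif_seplip K F j : seplip K F -> seplip (K + K) (dif j F).
Proof.
move=> FK; rewrite /dif => i y e.
have := FK i y e; have := FK i (y + delta j *: ev j) e.
rewrite addrAC; set a := F _; set b := F _; set c := F _; set d := F _.
move=> H1 H2; rewrite mulrDl (_ : _ - _ = (c - d) - (a - b)); last by ring.
by apply: le_trans (ler_normB _ _) _; apply: lerD.
Qed.

Lemma dif_bounded M F j : (forall y, `|F y| <= M) -> forall y, `|dif j F y| <= M + M.
Proof. by move=> FM y; apply: le_trans (ler_normB _ _) _; apply: lerD. Qed.

(** A shift of the argument of the kernel [k] by half a wave length in each variable
    flips its sign; this plays the role of integration by parts. *)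
Lemma intcs_difs (k : 'rV[R]_s -> R) (Kk : R) js r F K M y :
  (forall x, `|k x| <= 1) -> seplip Kk k -> periodic1 k ->
  (forall j, j \in r -> 0 <= delta j /\ forall x, k (x + delta j *: ev j) = - k x) ->
  {subset r <= js} ->
  seplip K F -> (forall x, `|F x| <= M) -> periodic1 F ->
  intcs js (fun x => difs r F x * k x) y = 2 ^+ size r * intcs js (fun x => F x * k x) y.
Proof.
move=> k1 kl kp kflip; elim: r F K M kflip => [|j r IH] F K M kflip rjs FK FM pF.
  by rewrite expr0 mul1r.
rewrite [difs (j :: r) F]/(difs r (dif j F)).
rewrite (IH _ (K + K) (M + M)); first last.
- exact: dif_periodic.
- exact: dif_bounded.
- exact: dif_seplip.
- by move=> i ir; apply: rjs; rewrite inE ir orbT.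
- by move=> i ir; apply: kflip; rewrite inE ir orbT.
have [d0 flip] := kflip j (mem_head _ _).
have FkL := seplipM _ _ _ _ _ _ FK kl FM k1.
have FkLs : seplip (K * 1 + M * Kk) (fun x => F (x + delta j *: ev j) * k (x + delta j *: ev j)).
  by move=> i x e; rewrite addrAC; exact: FkL.
have pFk : periodic1 (fun x => F x * k x) by move=> i x; rewrite pF kp.
(* The sign flip of the kernel turns the difference into the sum of [F k] and its translate. Both
   have the same integral, whence one factor [2] per difference. *)
rewrite (_ : (fun x => dif j F x * k x) =
    (fun x => F x * k x + F (x + delta j *: ev j) * k (x + delta j *: ev j))); last first.
  by apply/funext => x; rewrite flip /dif; ring.
rewrite (intcsD _ _ _ _ _ _ FkL FkLs).
rewrite (intcs_shift _ (fun x => F x * k x) js j (delta j) y FkL pFk d0); last first.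
  by apply: rjs; rewrite mem_head.
by rewrite /= exprS; ring.
Qed.

End FiniteDifferences.

(** * Reduction of periodic functions to the unit cube *)

Section Periodicity.
Context {R : realType} {s : nat}.
Implicit Types (F : 'rV[R]_s -> R) (y : 'rV[R]_s).

Lemma periodic1_int F (j : 'I_s) (n : int) y : periodic1 F -> F (y + n%:~R *: ev j) = F y.
Proof.
move=> pF; have nat_case (m : nat) x : F (x + m%:R *: ev j) = F x.
  elim: m => [|m IH]; first by rewrite scale0r addr0.
  by rewrite -natr1 scalerDl scale1r addrA pF IH.
case: n => m; first exact: nat_case.
by rewrite -(nat_case m.+1) NegzE rmorphN scaleNr subrK.
Qed.

Lemma periodic1_cube F (P : R -> Prop) : periodic1 F ->
  (forall y, cube y -> P (F y)) -> forall y, P (F y).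
Proof.
move=> pF cP y.
suff [y' [yy' y'c]] : exists y', F y' = F y /\ forall j, j \in enum 'I_s -> 0 <= y' 0 j <= 1.
  by rewrite -yy'; apply: cP => j; apply: y'c; rewrite mem_enum.
elim: (enum 'I_s) => [|j l [y' [yy' y'c]]]; first by exists y.
exists (y' + (- Num.floor (y' 0 j))%:~R *: ev j); split; first by rewrite periodic1_int.
move=> i; rewrite inE !mxE eqxx /=; have [->|ij] := eqVneq i j => [_|/= il].
  rewrite mulr1 rmorphN/= subr_ge0 floor_le_tmp/= lerBlDr addrC.
  by rewrite -intrD1 ltW// floorD1_gt.
by rewrite mulr0 addr0; exact: y'c.
Qed.

Lemma pd_periodic F j : periodic1 F -> periodic1 (pd j F).
Proof.
move=> pF i y; rewrite -(derive_shiftE _ _ _ _).2; congr (pd j _ y).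
by apply/funext => x; exact: pF.
Qed.

Lemma pdr_periodic r F : periodic1 F -> periodic1 (pdr r F).
Proof. by elim: r F => [//|j r IH] F pF; apply/IH/pd_periodic. Qed.

End Periodicity.

(** * Decay of Fourier coefficients through half-period differences *)

Section Fourier.
Context {R : realType} {s : nat}.
Implicit Types (F : 'rV[R]_s -> R) (y : 'rV[R]_s) (h : 'I_s -> int).

Let phase h y : R := 2 * pi * \sum_j (h j)%:~R * y 0 j.

(** The phases [c = 0] and [c = - pi / 2] give the cosine and sine kernels, so one estimate covers
    both parts of a Fourier coefficient. *)
Definition wave h (c : R) y : R := cos (phase h y + c).

Definition half_period h (j : 'I_s) : R := (2 * `|h j|%:~R)^-1.

Let phase_shift h y e j : phase h (y + e *: ev j) = phase h y + 2 * pi * ((h j)%:~R * e).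
Proof.
rewrite /phase -mulrDr; congr (_ * _).
rewrite (bigD1 j)//= [in RHS](bigD1 j)//= !mxE !eqxx/= mulr1 mulrDr addrAC.
congr (_ + _ + _); apply: eq_bigr => i ij.
by rewrite !mxE eqxx/= (negbTE ij) mulr0 addr0.
Qed.

Lemma wave_le1 h c y : `|wave h c y| <= 1.
Proof. by rewrite ler_norml cos_geN1 cos_le1. Qed.

Lemma wave_half h c j y : h j != 0 -> wave h c (y + half_period h j *: ev j) = - wave h c y.
Proof.
move=> hj; rewrite /wave phase_shift /half_period addrAC.
have h0 : (h j)%:~R != 0 :> R by rewrite intr_eq0.
case: (ger0P (h j)) => hs.
  rewrite (_ : 2 * pi * _ = pi); first exact: cosDpi.
  by field.
rewrite (_ : 2 * pi * _ = - pi); last by rewrite rmorphN /=; field.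
by rewrite cosB cospi sinpi; ring.
Qed.

Lemma wave_periodic h c : periodic1 (wave h c).
Proof.
move=> j y; have [h0|hj] := eqVneq (h j) 0.
  by rewrite /wave -[ev j]scale1r phase_shift h0 mul0r mulr0 addr0.
(* The period [1] consists of [2 |h_j|] half periods, an even number of sign changes. *)
have flip n x : wave h c (x + (n%:R * half_period h j) *: ev j) = (-1) ^+ n * wave h c x.
  elim: n x => [|n IH] x; first by rewrite mul0r scale0r addr0 mul1r.
  by rewrite -natr1 mulrDl mul1r scalerDl addrA wave_half// IH exprS mulN1r mulNr.
have := flip (2 * `|h j|)%N y.
rewrite exprM sqrrN !expr1n mul1r (_ : _ * half_period h j = 1) ?scale1r//.
have n0 : `|h j|%:~R != 0 :> R by rewrite intr_eq0 normr_eq0.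
by rewrite natrM /half_period natr_absz divff// mulf_eq0 pnatr_eq0 (negbTE n0).
Qed.

Lemma wave_seplip h c : exists K, seplip K (wave h c).
Proof.
exists (\sum_j `|2 * pi * (h j)%:~R|) => j y e.
have cl (a b : R) : `|cos b - cos a| <= 1 * `|b - a|.
  apply: derivable_lipschitz => x; first exact: derivable_cos.
  by rewrite derive1E derive_val normrN ler_norml sin_geN1 sin_le1.
apply: le_trans (cl _ _) _; rewrite mul1r phase_shift.
rewrite (_ : _ - _ = 2 * pi * (h j)%:~R * e); last by ring.
rewrite normrM ler_wpM2r// (bigD1 j)//= lerDl sumr_ge0//.
Qed.

Lemma fourier_absE h F : fourier_abs h F =
  Num.sqrt ((intcs (enum 'I_s) (fun y => F y * wave h 0 y) 0) ^+ 2 +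
            (intcs (enum 'I_s) (fun y => F y * wave h (- (pi / 2)) y) 0) ^+ 2).
Proof.
rewrite /fourier_abs (_ : (fun y => F y * wave h 0 y) = fun y => F y * cos (phase h y)).
  rewrite (_ : (fun y => F y * wave h (- (pi / 2)) y) = fun y => F y * sin (phase h y))//.
  by apply/funext => y; rewrite /wave cosBpihalf.
by apply/funext => y; rewrite /wave addr0.
Qed.

Lemma intcs_norm_le_everywhere js F M y : (forall x, `|F x| <= M) -> `|intcs js F y| <= M.
Proof. by move=> FM; apply: (@intcs_norm_le _ _ finset.set0) => // j; rewrite inE. Qed.

(** Each of the [a |u|] differences contributes a factor [1/2] from the doubling of the integral and
    a factor [1 / (2 |h_j|)] from its step. The powers of [|h_j|] cancel against the weight and
    [4^-1] per difference remains. *)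
Lemma intcs_wave_le h c F (a : nat) (B K M : R) :
  (forall n, pdiff setT n F) -> periodic1 F -> seplip K F -> (forall y, `|F y| <= M) ->
  let u := [set j | h j != 0]%SET in
  (forall y, `|pdr (mblocks (ind_idx a u)) F y| <= B) ->
  `|intcs (enum 'I_s) (fun y => F y * wave h c y) 0| *
     \prod_(j | h j != 0) (`|h j|%:~R ^+ a) <= (4^-1) ^+ (a * #|u|) * B.
Proof.
move=> pF perF FK FM u FB; set r := mblocks (ind_idx a u).
have ru j : j \in r -> h j != 0.
  move=> /flattenP [_ /mapP [i _ ->]]; rewrite mem_nseq /ind_idx.
  by case: ifP => // + /andP[_ /eqP ->]; rewrite inE.
have [Kw wK] := wave_seplip h c.
have d0 j : 0 <= half_period h j by rewrite invr_ge0 mulr_ge0// ler0z.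
have := @intcs_difs R s (half_period h) (wave h c) Kw (enum 'I_s) r F K M 0
  (wave_le1 h c) wK (wave_periodic h c) _ _ FK FM perF.
rewrite size_mblocks nabs_ind => E.
have {E} E := E (fun j jr => conj (d0 j) (fun x => wave_half h c j x (ru j jr)))
  (fun j _ => mem_enum 'I_s j).
have UD : `|intcs (enum 'I_s) (fun x => difs (half_period h) r F x * wave h c x) 0| <=
    (\prod_(j <- r) `|half_period h j|) * B.
  apply: intcs_norm_le_everywhere => x; rewrite normrM -[leRHS]mulr1.
  by apply: ler_pM => //; [exact: difs_le|exact: wave_le1].
have pE : (\prod_(j <- r) `|half_period h j|) * \prod_(j | h j != 0) (`|h j|%:~R ^+ a) =
    (2^-1) ^+ (a * #|u|).
  rewrite prod_mblocks exprM -prodr_const [\prod_(j in u) _]big_mkcond.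
  rewrite [X in _ * X]big_mkcond -big_split/=; apply: eq_bigr => j _.
  rewrite /ind_idx !inE; case: ifPn => [hj|_]; last by rewrite expr0 mul1r.
  rewrite -exprMn; congr (_ ^+ a); rewrite ger0_norm// /half_period invfM.
  by rewrite mulfVK// intr_eq0 normr_eq0.
move: UD; rewrite E normrM ger0_norm ?exprn_ge0// => UD.
have P0 : 0 <= \prod_(j | h j != 0) (`|h j|%:~R ^+ a) :> R.
  by apply: prodr_ge0 => j _; rewrite exprn_ge0// ler0z.
have UD' : 2 ^+ (a * #|u|) * `|intcs (enum 'I_s) (fun x => F x * wave h c x) 0| *
    \prod_(j | h j != 0) (`|h j|%:~R ^+ a) <= 2^-1 ^+ (a * #|u|) * B.
  by rewrite -pE [leRHS]mulrAC ler_wpM2r.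
have -> : (4^-1 : R) ^+ (a * #|u|) = 2^-1 ^+ (a * #|u|) * 2^-1 ^+ (a * #|u|).
  by rewrite -exprMn; congr (_ ^+ _); field.
have t0 : 0 < 2 ^+ (a * #|u|) :> R by rewrite exprn_gt0.
rewrite -(ler_pM2l t0) mulrA (le_trans UD')// -mulrA [leRHS]mulrA -exprMn.
by rewrite divff ?pnatr_eq0// expr1n mul1r.
Qed.

(** The modulus of a coefficient is at most the sum of its cosine and sine parts. The resulting
    factor [2] is absorbed by [4^-1] when [h] is nonzero. *)
Lemma korobov_norm_le (a : nat) (gamma : {set 'I_s} -> R) F (B : ('I_s -> nat) -> R) :
  (1 <= a)%N -> (forall u, 0 < gamma u) ->
  (forall n, pdiff setT n F) -> periodic1 F ->
  (forall nu y, `|pdr (mblocks nu) F y| <= B nu) ->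
  korobov_norm a gamma F <=
    \big[Num.max/0]_(u : {set 'I_s}) ((gamma u)^-1 * B (ind_idx a u)).
Proof.
move=> a1 g0 pF perF FB.
have FM y : `|F y| <= B (fun=> 0%N).
  rewrite -[F]/(pdr [::] F) (_ : [::] = mblocks (fun=> 0%N))//.
  by apply/esym/size0nil; rewrite size_mblocks /nabs big1.
(* Each first derivative is a multi-index derivative, and the sum of their bounds is a Lipschitz
   constant. *)
have [K FK] : exists K, seplip K F.
  have /choice[nu nuE] j : exists nu : 'I_s -> nat, [:: j] = mblocks nu.
    have [|nu E _] := @subseq_mblocks s (fun=> 1%N) [:: j]; last by exists nu.
    rewrite sub1seq; apply/flattenP; exists [:: j]; last by rewrite mem_head.
    by apply/mapP; exists j; rewrite // mem_rev mem_enum.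
  exists (\sum_j B (nu j)); apply: seplip_pd (pF 0%N) _ => j y.
  rewrite -[pd j F]/(pdr [:: j] F) nuE; apply: le_trans (FB _ _) _.
  rewrite (bigD1 j)//= lerDl; apply: sumr_ge0 => i _.
  exact: le_trans (normr_ge0 _) (FB (nu i) 0).
apply: ge_sup; first by exists (fourier_abs (fun=> 0) F * r_alpha a gamma (fun=> 0)), (fun=> 0).
move=> _ [h ->]; set u := [set j | h j != 0]%SET.
apply: le_trans (le_bigmax _ _ u); rewrite /r_alpha -/u mulrCA.
apply: ler_wpM2l; first by rewrite invr_ge0 ltW.
have B0 : 0 <= B (ind_idx a u) := le_trans (normr_ge0 _) (FB (ind_idx a u) 0).
rewrite fourier_absE; set X := intcs _ _ _; set Y := intcs _ _ _.
set P := \prod_(j | _) _.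
have P0 : 0 <= P by apply: prodr_ge0 => j _; rewrite exprn_ge0// ler0z.
have XP := intcs_wave_le h 0 F a _ _ _ pF perF FK FM (FB _).
have YP := intcs_wave_le h (- (pi / 2)) F a _ _ _ pF perF FK FM (FB _).
rewrite -/X -/u -/P in XP; rewrite -/Y -/u -/P in YP.
apply: (@le_trans _ _ ((`|X| + `|Y|) * P)).
  apply: ler_wpM2r => //; rewrite -(ger0_norm (addr_ge0 (normr_ge0 X) (normr_ge0 Y))).
  rewrite -sqrtr_sqr; apply: ler_wsqrtr; rewrite sqrrD !real_normK ?num_real// lerD2r lerDl.
  by rewrite mulrn_wge0// mulr_ge0.
(* For [h = 0] no difference is taken and no factor [4^-1] is gained, but then the sine part
   vanishes. *)
rewrite mulrDl; have [u0|u0] := posnP #|u|.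
  have h0 j : h j = 0.
    by apply/eqP; move: (card0_eq u0 j); rewrite inE => /negbFE.
  have -> : Y = 0.
    apply/eqP; rewrite -normr_le0; apply: intcs_norm_le_everywhere => x.
    rewrite /wave cosBpihalf /phase big1 => [|j _]; last by rewrite h0 mul0r.
    by rewrite mulr0 sin0 mulr0 normr0.
  by move: XP; rewrite normr0 mul0r addr0 u0 muln0 mul1r.
apply: le_trans (lerD XP YP) _; rewrite -mulrDl ler_piMl//.
have le4 : 4^-1 ^+ (a * #|u|) <= 4^-1 :> R.
  rewrite -[leRHS]expr1; apply: ler_wiXn2l; rewrite ?muln_gt0 ?a1 ?u0//; lra.
lra.
Qed.

End Fourier.

(** [S_L] contains only [P_0] to [P_(L-1)], hence only [R_1] to [R_(L-1)]. Thus [P_k] is at most the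
    [k]-th power of [xi tau rho], and the geometric sum remains. *)
Lemma SL_le {R : realType} (xi tau rho : R) (Rl : nat -> R) (L : nat) :
  0 < xi -> 0 < tau -> (forall l, (1 <= l <= L.-1)%N -> 0 < Rl l <= rho) ->
  SL xi tau Rl L <= (if xi * tau * rho == 1 then tau * L%:R
    else tau * (((xi * tau * rho) ^+ L - 1) / (xi * tau * rho - 1))).
Proof.
move=> xi0 tau0 Rrho; set x := xi * tau * rho.
have Pk_le k : (k <= L.-1)%N -> 0 <= Pk xi tau Rl k <= x ^+ k.
  elim: k => [|k IH] kL; first by rewrite /Pk big_geq// ler01 lexx.
  have /andP[P0 Px] := IH (ltnW kL); have /andP[R0 Rr] := Rrho k.+1 kL.
  have xt0 : 0 < xi * tau by rewrite mulr_gt0.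
  have xtR : 0 <= xi * tau * Rl k.+1 by rewrite mulr_ge0 ?ltW.
  by rewrite PkS exprSr mulr_ge0//= ler_pM// ler_pM2l.
have le_geo : SL xi tau Rl L <= tau * \sum_(k < L) x ^+ k.
  rewrite /SL big_mkord; apply: ler_wpM2l; first exact: ltW.
  apply: ler_sum => k _; have kL : (k <= L.-1)%N by case: (L) k => [[]//|m] k; exact: leq_ord.
  by have /andP[] := Pk_le k kL.
apply: le_trans le_geo _; case: eqP => [->|/eqP x1].
  under eq_bigr do rewrite expr1n.
  by rewrite sumr_const card_ord.
by rewrite subrX1 mulrAC divff ?subr_eq0// mul1r.
Qed.

(** * Squared difference of two functions with a common majorant *)

Section Dominated.
Context {R : realType} {s : nat}.
Implicit Types (F G : 'rV[R]_s -> R) (y : 'rV[R]_s) (nu : 'I_s -> nat).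
Variables (C : R) (b : nat -> R) (kappa : nat -> R).

Let M k nu := geo_pow (coordb b) kappa k (mblocks nu).

(** The difference has majorant [2 C / (1 - z)], and the square of this series is
    [4 C^2 / (1 - z)^2], which is [4 C^2] times [geo_pow] at [k = 1]. This is where [(|m| + 1)!]
    comes from. *)
Lemma dominated_sqrB (E : set 'rV[R]_s) F G y : open E -> E y ->
  (forall n, pdiff E n F) -> (forall n, pdiff E n G) ->
  (forall nu, `|pdr (mblocks nu) F y| <= C * M 0 nu) ->
  (forall nu, `|pdr (mblocks nu) G y| <= C * M 0 nu) ->
  forall nu, `|pdr (mblocks nu) (fun x => (F x - G x) ^+ 2) y| <= 4 * C ^+ 2 * M 1 nu.
Proof.
move=> Eo Ey pF pG FC GC nu; set r := mblocks nu.
have pFG n : pdiff E n (fun x => F x - G x) by exact: pdiffB.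
pose f : shuf R 'I_s := cst_shuf (2 * C) * geo_pow (coordb b) kappa 0.
have FGf r' : subseq r' r -> `|pdr r' (fun x => F x - G x) y| <= f r'.
  move=> /subseq_mblocks [nu' -> _]; rewrite /f cst_shufM (pdrB _ Eo)//.
  apply: le_trans (ler_normB _ _) _.
  by rewrite mulr_natl mulrnAl mulr2n; apply: lerD; [exact: FC|exact: GC].
have := pdrM_le E Eo r _ _ f f y (pFG _) (pFG _) Ey FGf FGf.
rewrite (_ : f * f = cst_shuf (4 * C ^+ 2) * geo_pow (coordb b) kappa 1).
  by rewrite cst_shufM.
rewrite /f /geo_pow (_ : 1`! = 1%N)// (_ : 0`! = 1%N)// rmorph1 !mul1r expr1.
rewrite (_ : 4 * C ^+ 2 = (2 * C) * (2 * C)); last by ring.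
by rewrite (rmorphM (cst_shuf : R -> shuf R 'I_s)) /=; ring.
Qed.

End Dominated.

(** * Periodicity of the network, the open cube, and the assembly of the norm bounds *)

Lemma net_periodic {R : realType} (d : nat -> nat) (W : forall l, 'M[R]_(d l.+1, d l))
  (v : forall l, 'I_(d l.+1) -> R) (sigma : R -> R) l p :
  periodic1 (fun y => net W v sigma phi_sin l y p).
Proof.
move=> j y; elim: l p => [|l IH] p /=; last by congr (_ + _); apply: eq_bigr => q _; rewrite IH.
congr (_ + _); apply: eq_bigr => i _; congr (_ * _); rewrite !mxE eqxx/=.
by case: eqP => _; rewrite ?addr0// phi_sin_periodic.
Qed.

Lemma ocube_open {R : realType} {s : nat} : open (@ocube R s).
Proof.
rewrite openE => y yo.
have H j : \forall z \near y, 0 < (z : 'rV[R]_s) 0 j < 1.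
  have h : \forall t \near (y 0 j : R), 0 < t < 1.
    have := @near_in_itvoo R 0 1 (y 0 j); rewrite in_itv/= => /(_ (yo j)).
    by apply: filterS => t; rewrite in_itv.
  exact: (@coord_continuous R 1 s 0 j y _ h).
exact: filter_forall H.
Qed.

Lemma pdiff_setT {R : realType} {s : nat} (E : set 'rV[R]_s) n F : pdiff setT n F -> pdiff E n F.
Proof.
elim: n F => [|n IH] F [dF pF]; split=> //; try by move=> y j _; exact: dF.
by move=> j; apply/IH/pF.
Qed.

Lemma ocube_cube {R : realType} {s : nat} (y : 'rV[R]_s) : ocube y -> cube y.
Proof. by move=> yo j; have /andP[y0 y1] := yo j; rewrite !ltW. Qed.

Theorem theorem3p2 (R : realType) (L : nat) (d : nat -> nat)
  (W : forall l : nat, 'M[R]_(d l.+1, d l)) (v : forall l : nat, 'I_(d l.+1) -> R)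
  (sigma : R -> R) (xi tau : R) (Rl : nat -> R) (b : nat -> R) (C rho : R)
  (gamma : {set 'I_(d 0%N)} -> R) :
  (1 <= d 0%N)%N -> (1 <= L)%N ->
  (* sigma smooth, sup_x |sigma^(n)(x)| <= xi tau^n n! for n >= 1 *)
  (forall (n : nat) (x : R), derivable (derive1n n sigma) x 1) ->
  0 < xi -> 0 < tau ->
  (forall (n : nat) (x : R), (1 <= n)%N ->
      `|derive1n n sigma x| <= xi * tau ^+ n * n`!%:R) ->
  (* ||W_l||_infty <= R_l, R_l > 0 *)
  (forall l : nat, (1 <= l <= L)%N -> 0 < Rl l /\ mxinf (W l) <= Rl l) ->
  (forall j : nat, (1 <= j)%N -> 0 < b j) -> 0 < C ->
  (* parameter restrictions *)
  0 < rho -> (forall l : nat, (1 <= l <= L.-1)%N -> Rl l <= rho) ->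
  (forall (p : 'I_(d 1%N)) (j : 'I_(d 0%N)),
      `|W 0%N p j| <= b (nat_of_ord j).+1 / SL xi tau Rl L) ->
  (* weights *)
  (forall u, 0 < gamma u) -> gamma finset.set0 = 1 ->
  (* bound on S_L *)
  (SL xi tau Rl L <= (if xi * tau * rho == 1 then tau * L%:R
                      else tau * (((xi * tau * rho) ^+ L - 1) / (xi * tau * rho - 1)))) /\
  (* (a) non-periodic network *)
  (CL (net W v sigma phi_id L) xi tau Rl L <= C ->
   forall G : 'I_(d L.+1) -> 'rV[R]_(d 0%N) -> R,
   (forall p, smooth_on ocube (G p)) ->
   (forall p (nu : 'I_(d 0%N) -> nat) y, ocube y ->
      `|dnu nu (G p) y| <= boundA C b nu) ->
   (forall p (nu : 'I_(d 0%N) -> nat) y, cube y ->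
      `|dnu nu (fun z => net W v sigma phi_id L z p) y| <= boundA C b nu) /\
   (forall p,
      Num.max (wnorm2 1 gamma (G p)) (wnorm2 1 gamma (fun z => net W v sigma phi_id L z p))
      <= C ^+ 2 * \sum_(u : {set 'I_(d 0%N)}) (gamma u)^-1 *
            ((#|u|)`!%:R * \prod_(j in u) b (nat_of_ord j).+1) ^+ 2) /\
   (forall p,
      wnorm2 1 gamma (fun z => (G p z - net W v sigma phi_id L z p) ^+ 2)
      <= 16 * C ^+ 4 * \sum_(u : {set 'I_(d 0%N)}) (gamma u)^-1 *
            ((#|u|.+1)`!%:R * \prod_(j in u) b (nat_of_ord j).+1) ^+ 2)) /\
  (* (b), (c) periodic network *)
  (CL (net W v sigma phi_sin L) xi tau Rl L <= C ->
   forall G : 'I_(d L.+1) -> 'rV[R]_(d 0%N) -> R,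
   (forall p, smooth_on setT (G p)) ->
   (forall p, periodic1 (G p)) ->
   (forall p (nu : 'I_(d 0%N) -> nat) y, cube y ->
      `|dnu nu (G p) y| <= boundB C b nu) ->
   ((forall p (nu : 'I_(d 0%N) -> nat) y, cube y ->
      `|dnu nu (fun z => net W v sigma phi_sin L z p) y| <= boundB C b nu) /\
    (forall (a : nat), (1 <= a)%N -> forall p,
      Num.max (wnorm2 a gamma (G p)) (wnorm2 a gamma (fun z => net W v sigma phi_sin L z p))
      <= C ^+ 2 * \sum_(u : {set 'I_(d 0%N)})
            (2 * pi) ^+ (2 * a * #|u|) / gamma u * (sumK b a u 0) ^+ 2) /\
    (forall (a : nat), (1 <= a)%N -> forall p,
      wnorm2 a gamma (fun z => (G p z - net W v sigma phi_sin L z p) ^+ 2)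
      <= 16 * C ^+ 4 * \sum_(u : {set 'I_(d 0%N)})
            (2 * pi) ^+ (2 * a * #|u|) / gamma u * (sumK b a u 1) ^+ 2)) /\
   ((forall (a : nat), (2 <= a)%N -> forall p,
      Num.max (korobov_norm a gamma (G p))
              (korobov_norm a gamma (fun z => net W v sigma phi_sin L z p))
      <= C * \big[Num.max/0]_(u : {set 'I_(d 0%N)})
               ((2 * pi) ^+ (a * #|u|) / gamma u * sumK b a u 0)) /\
    (forall (a : nat), (2 <= a)%N -> forall p,
      korobov_norm a gamma (fun z => (G p z - net W v sigma phi_sin L z p) ^+ 2)
      <= 4 * C ^+ 2 * \big[Num.max/0]_(u : {set 'I_(d 0%N)})
               ((2 * pi) ^+ (a * #|u|) / gamma u * sumK b a u 1)))).
Proof.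
move=> s1 L1 dsigma xi0 tau0 bsigma WR b0 C0 rho0 Rrho W0b g0 g1.
set s := d 0%N in gamma g0 g1 *.
have kid0 n : 0 <= kap_id n :> R by exact: ler0n.
have ksin0 n : 0 <= kap_sin n :> R by rewrite exprn_ge0// mulr_ge0// pi_ge0.
split; [|split].
- apply: SL_le => // l lL; rewrite Rrho// andbT.
  by have [] := WR l _ => //; move: lL; lia.
- move=> CLC G sG bG.
  set N := fun p (y : 'rV[R]_s) => net W v sigma phi_id L y p.
  have Ndom p r y : cube y -> `|pdr r (N p) y| <= C * geo_pow (coordb b) kap_id 0 r.
    exact: (net_dominated _ W v sigma phi_id xi tau C Rl kap_id b L L1 dsigma xi0 tau0 bsigma
      WR b0 W0b derivable_phi_id phi_id_bound kid0).
  (* [G] is smooth on the open cube only, so the network is restricted to it before the two are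
     compared. *)
  have Npd p n : pdiff ocube n (N p).
    by apply: pdiff_setT; exact: (net_pdiff d W v sigma phi_id dsigma derivable_phi_id).
  have Gdom p nu y : ocube y ->
      `|pdr (mblocks nu) (G p) y| <= C * geo_pow (coordb b) kap_id 0 (mblocks nu).
    by move=> oy; rewrite -dnuE geo_pow_boundA; exact: bG.
  have term0 c (u : {set 'I_s}) :
      c ^+ 2 * ((gamma u)^-1 * ((#|u|)`!%:R * \prod_(j in u) b (nat_of_ord j).+1) ^+ 2) =
      (gamma u)^-1 * (c * geo_pow (coordb b) kap_id 0 (mblocks (ind_idx 1 u))) ^+ 2.
    by rewrite geo_pow_ind1 addn0; ring.
  have term1 c (u : {set 'I_s}) :
      c ^+ 2 * ((gamma u)^-1 * ((#|u|.+1)`!%:R * \prod_(j in u) b (nat_of_ord j).+1) ^+ 2) =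
      (gamma u)^-1 * (c * geo_pow (coordb b) kap_id 1 (mblocks (ind_idx 1 u))) ^+ 2.
    by rewrite geo_pow_ind1 addn1; ring.
  split; [|split].
  + by move=> p nu y cy; rewrite dnuE -geo_pow_boundA; exact: Ndom.
  + move=> p; rewrite mulr_sumr (eq_bigr _ (fun u _ => term0 C u)) ge_max.
    apply/andP; split; apply: wnorm2_le => // u y oy; rewrite dalphaE dnuE; first exact: Gdom.
    by apply/Ndom/ocube_cube.
  + move=> p; rewrite mulr_sumr (_ : 16 * C ^+ 4 = (4 * C ^+ 2) ^+ 2); last by ring.
    rewrite (eq_bigr _ (fun u _ => term1 (4 * C ^+ 2) u)).
    apply: wnorm2_le => // u y oy; rewrite dalphaE dnuE.
    apply: (dominated_sqrB _ _ _ _ (G p) (N p) y ocube_open oy _ (Npd p)) => //.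
    * by move=> n; exact: smooth_pdiff.
    * by move=> nu; exact: Gdom.
    * by move=> nu; apply/Ndom/ocube_cube.
- move=> CLC G sG pG bG.
  set N := fun p (y : 'rV[R]_s) => net W v sigma phi_sin L y p.
  have Npd p n : pdiff setT n (N p).
    exact: (net_pdiff d W v sigma phi_sin dsigma derivable_phi_sin).
  have Gpd p n : pdiff setT n (G p) by exact: smooth_pdiff.
  have Nper p : periodic1 (N p) by exact: net_periodic.
  (* Half-period shifts leave the cube, so the bounds are extended to the whole space by
     periodicity. *)
  have Ndom p r y : `|pdr r (N p) y| <= C * geo_pow (coordb b) kap_sin 0 r.
    apply: (periodic1_cube (pdr r (N p)) (fun t => `|t| <= _)) y; first exact: pdr_periodic.
    move=> x cx; exact: (net_dominated _ W v sigma phi_sin xi tau C Rl kap_sin b L L1 dsigma xi0 tau0 bsigma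
      WR b0 W0b derivable_phi_sin phi_sin_bound ksin0 p r x CLC cx).
  have Gdom p nu y : `|pdr (mblocks nu) (G p) y| <= C * geo_pow (coordb b) kap_sin 0 (mblocks nu).
    apply: (periodic1_cube (pdr (mblocks nu) (G p)) (fun t => `|t| <= _)) y.
      exact: pdr_periodic.
    by move=> x cx; rewrite -dnuE geo_pow_boundB; exact: bG.
  have Ddom p nu y : `|pdr (mblocks nu) (fun x => (G p x - N p x) ^+ 2) y| <=
      4 * C ^+ 2 * geo_pow (coordb b) kap_sin 1 (mblocks nu).
    exact: (dominated_sqrB _ _ _ _ (G p) (N p) y openT I _ (Npd p)).
  have Dpd p n : pdiff setT n (fun x => (G p x - N p x) ^+ 2).
    by apply: (pdiffM _ openT); exact: (pdiffB _ openT).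
  have Dper p : periodic1 (fun x => (G p x - N p x) ^+ 2).
    by move=> j y; rewrite pG Nper.
  have term c a k (u : {set 'I_s}) :
      c ^+ 2 * ((2 * pi) ^+ (2 * a * #|u|) / gamma u * sumK b a u k ^+ 2) =
      (gamma u)^-1 * (c * geo_pow (coordb b) kap_sin k (mblocks (ind_idx a u))) ^+ 2.
    by rewrite geo_pow_sumK -mulnA mulnC (exprM _ _ 2); move: ((2 * pi) ^+ (a * #|u|)) => w; ring.
  have kor a F c k : (2 <= a)%N -> 0 <= c -> (forall n, pdiff setT n F) -> periodic1 F ->
      (forall nu y, `|pdr (mblocks nu) F y| <= c * geo_pow (coordb b) kap_sin k (mblocks nu)) ->
      korobov_norm a gamma F <= c * \big[Num.max/0]_(u : {set 'I_s})
        ((2 * pi) ^+ (a * #|u|) / gamma u * sumK b a u k).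
    move=> a2 c0 pF perF Fdom.
    apply: le_trans (korobov_norm_le a gamma F _ (ltnW a2) g0 pF perF Fdom) _.
    (* The maximum starts from [0], so the constant [c] is compared term by term and the starting
       value is treated separately. *)
    apply: bigmax_le => [|u _]; first by rewrite mulr_ge0// bigmax_ge_id.
    rewrite geo_pow_sumK [leLHS](_ : _ = c * ((2 * pi) ^+ (a * #|u|) / gamma u * sumK b a u k)).
      exact: ler_wpM2l (le_bigmax _ _ u).
    by ring.
  have C2 : 0 <= 4 * C ^+ 2 by rewrite mulr_ge0// sqr_ge0.
  split; [split; [|split]|split].
  + by move=> p nu y cy; rewrite dnuE -geo_pow_boundB; exact: Ndom.
  + move=> a a1 p; rewrite mulr_sumr (eq_bigr _ (fun u _ => term C a 0%N u)) ge_max.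
    apply/andP; split; apply: wnorm2_le => // u y _; rewrite dalphaE dnuE; first exact: Gdom.
    exact: Ndom.
  + move=> a a1 p; rewrite mulr_sumr (_ : 16 * C ^+ 4 = (4 * C ^+ 2) ^+ 2); last by ring.
    rewrite (eq_bigr _ (fun u _ => term (4 * C ^+ 2) a 1%N u)).
    by apply: wnorm2_le => // u y _; rewrite dalphaE dnuE; exact: Ddom.
  + move=> a a2 p; rewrite ge_max; apply/andP.
    split; first exact: (kor a (G p) C 0%N a2 (ltW C0) (Gpd p) (pG p) (Gdom p)).
    exact: (kor a (N p) C 0%N a2 (ltW C0) (Npd p) (Nper p) (fun nu y => Ndom p _ y)).
  + move=> a a2 p.
    exact: (kor a _ (4 * C ^+ 2) 1%N a2 C2 (Dpd p) (Dper p) (Ddom p)).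
Qed.
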